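(* Assume (H1), (H2), $\lambda>L$, and that $t\mapsto\pi(t)$ is weak-* lower semicontinuous: $\int_X c(f)\,\pi(t)(df)\le\liminf_{s\to t}\int_X c(f)\,\pi(s)(df)$ for all $t\ge0$ and all $c\in C^0(X)$. Fix $t\ge0$ and $x\in\mathbb{R}^n$, and let $\sigma^*\in\mathcal{R}$ be an optimal relaxed control for $V(t,x)$, i.e. $V(t,x)=\int_0^\infty\int_X e^{-\lambda\tau}J(x^f(\tau),\sigma^*(\tau))\,\pi(t)(df)\,d\tau$ with $x^f$ solving $\dot x^f=f(x^f,\sigma^* )$, $x^f(0)=x$. Define $g(s)=\int_0^\infty\int_X e^{-\lambda\tau}J(x^f(\tau),\sigma^*(\tau))\,\pi(s)(df)\,d\tau$. Then $g$ is lower semicontinuous (so its strict subdifferential is well defined) and $$\hat\partial_t V(t,x)\subseteq\hat\partial_t g(t).$$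
   Context: $U\subset\mathbb{R}^m$ compact; $\mathcal{U}$: measurable functions $[0,\infty)\to U$; $\mathcal{R}$: Borel measurable maps $[0,\infty)\to\mathrm{r.p.m.}(U)$ (relaxed controls), with $f(x,\mu)=\int_U f(x,r)\mu(dr)$, $J(x,\mu)=\int_U J(x,r)\mu(dr)$. (H1): $X$ is a nonempty set of functions $f:\mathbb{R}^n\times U\to\mathbb{R}^n$, compact in the topology of uniform convergence on compact sets, with constants $L,C>0$ such that $|f(x,u)-f(x',u')|\le L(|x-x'|+|u-u'|)$, $|f(x,u)|\le C$ for all arguments and all $f\in X$. (H2): $J:\mathbb{R}^n\times U\to\mathbb{R}$ continuous with $|J(x,u)-J(x',u)|\le L_J|x-x'|$. $\lambda>0$. $\pi:[0,\infty)\to\mathrm{r.p.m.}(X)$. Value function: $V(t,x)=\inf_{u\in\mathcal{U}}\int_0^\infty\int_X e^{-\lambda\tau}J(x^f(\tau),u(\tau))\,\pi(t)(df)\,d\tau$ with $\dot x^f=f(x^f,u)$, $x^f(0)=x$ (this infimum equals the minimum over $\mathcal{R}$). Strict subdifferential of a lower semicontinuous scalar function $g$ at $t$: $\hat\partial_t g(t)=\{\xi\in\mathbb{R}:\ \limsup_{s\to t}\frac{\xi(s-t)-(g(s)-g(t))}{|s-t|}\le0\}$; $\hat\partial_tV(t,x)$ denotes this set for $s\mapsto V(s,x)$. *)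

(* Defs.v *)
From HB Require Import structures.
From mathcomp Require Import all_boot all_order all_algebra.
From mathcomp Require Import all_classical all_reals all_analysis.
From mathcomp Require Import measurable_realfun.
Import Order.TTheory GRing.Theory Num.Theory.
Import numFieldNormedType.Exports.

Set Implicit Arguments.
Unset Strict Implicit.
Unset Printing Implicit Defensive.

Local Open Scope classical_set_scope.
Local Open Scope ring_scope.

Notation borel T := (g_sigma_algebraType (@open T)).

Section Defs.
Variables (R : realType) (n m : nat).

Definition enorm k (v : 'rV[R]_k) : R := Num.sqrt (\sum_(i < k) v ord0 i ^+ 2).

Definition dom (U : set 'rV[R]_m) := ('rV[R]_n * set_type U)%type.

Definition FT (U : set 'rV[R]_m) := {family compact, dom U -> 'rV[R]_n}.

(** Extension by 0 of a function on U to all of R^m (only used inside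
    integrals against measures concentrated on U). *)
Definition extU (U : set 'rV[R]_m) (h : set_type U -> R) (r : 'rV[R]_m) : R :=
  match pselect (U r) with
  | left Ur => h (SigSub (mem_set Ur))
  | right _ => 0
  end.

Definition H1 (U : set 'rV[R]_m) (X : set (FT U)) (L C : R) : Prop :=
  X !=set0 /\ compact X /\ 0 < L /\ 0 < C /\
  (forall f, X f -> forall (x x' : 'rV[R]_n) (u u' : set_type U),
      enorm (f (x, u) - f (x', u')) <= L * (enorm (x - x') + enorm (val u - val u'))) /\
  (forall f, X f -> forall (x : 'rV[R]_n) (u : set_type U), enorm (f (x, u)) <= C).

Definition H2 (U : set 'rV[R]_m) (J : dom U -> R) (LJ : R) : Prop :=
  continuous J /\
  forall (x x' : 'rV[R]_n) (u : set_type U), `|J (x, u) - J (x', u)| <= LJ * enorm (x - x').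

Definition ordinary_control (U : set 'rV[R]_m) (u : R -> set_type U) : Prop :=
  forall A : set 'rV[R]_m, open A ->
    measurable (`[0%R, +oo[ `&` (fun t => val (u t)) @^-1` A).

(** Relaxed controls: Borel measurable maps [0,oo) -> r.p.m.(U); a probability
    measure on U is represented as a Borel probability on R^m concentrated on U;
    measurability of t |-> sigma(t) is measurability of t |-> sigma(t)(A)
    for every Borel set A. *)
Definition relaxed_control (U : set 'rV[R]_m)
    (sigma : R -> probability (borel 'rV[R]_m) R) : Prop :=
  (forall t, 0 <= t -> sigma t U = 1%E) /\
  forall A : set (borel 'rV[R]_m), measurable A ->
    measurable_fun (`[0%R, +oo[ : set R) (fun t : R => (sigma t A : \bar R)).

(** y f is the (Caratheodory) solution on [0,oo) of  y' = f(y,u), y(0) = x,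
    for every f in X. *)
Definition ordinary_traj (U : set 'rV[R]_m) (X : set (FT U))
    (u : R -> set_type U) (x : 'rV[R]_n) (y : FT U -> R -> 'rV[R]_n) : Prop :=
  forall f, X f ->
    {within `[0%R, +oo[, continuous (y f)} /\
    forall t, 0 <= t -> forall i : 'I_n,
      y f t ord0 i = x ord0 i +
        \int[@lebesgue_measure R]_(s in `[0%R, t]) (f (y f s, u s)) ord0 i.

Definition relaxed_traj (U : set 'rV[R]_m) (X : set (FT U))
    (sigma : R -> probability (borel 'rV[R]_m) R) (x : 'rV[R]_n)
    (y : FT U -> R -> 'rV[R]_n) : Prop :=
  forall f, X f ->
    {within `[0%R, +oo[, continuous (y f)} /\
    forall t, 0 <= t -> forall i : 'I_n,
      y f t ord0 i = x ord0 i +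
        \int[@lebesgue_measure R]_(s in `[0%R, t])
           (\int[sigma s]_(r in U) extU (fun r' => (f (y f s, r')) ord0 i) r).

Definition ordinary_cost (U : set 'rV[R]_m) (X : set (FT U))
    (pi : R -> probability (borel (FT U)) R) (J : dom U -> R) (lambda : R)
    (u : R -> set_type U) (y : FT U -> R -> 'rV[R]_n) (s : R) : R :=
  \int[@lebesgue_measure R]_(tau in `[0%R, +oo[)
     \int[pi s]_(f in X) (expR (- lambda * tau) * J (y f tau, u tau)).

Definition relaxed_cost (U : set 'rV[R]_m) (X : set (FT U))
    (pi : R -> probability (borel (FT U)) R) (J : dom U -> R) (lambda : R)
    (sigma : R -> probability (borel 'rV[R]_m) R)
    (y : FT U -> R -> 'rV[R]_n) (s : R) : R :=
  \int[@lebesgue_measure R]_(tau in `[0%R, +oo[)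
     \int[pi s]_(f in X)
        (expR (- lambda * tau) *
           \int[sigma tau]_(r in U) extU (fun r' => J (y f tau, r')) r).

Definition value (U : set 'rV[R]_m) (X : set (FT U))
    (pi : R -> probability (borel (FT U)) R) (J : dom U -> R) (lambda : R)
    (s : R) (x : 'rV[R]_n) : R :=
  inf [set c | exists (u : R -> set_type U) (y : FT U -> R -> 'rV[R]_n),
          [/\ ordinary_control u, ordinary_traj X u x y &
              c = ordinary_cost X pi J lambda u y s]].

End Defs.

Definition lsc_at {R : realType} (h : R -> R) (t : R) : Prop :=
  forall e : R, 0 < e -> exists d : R, 0 < d /\
    forall s, 0 <= s -> `|s - t| < d -> h t - e < h s.

(** Strict (Frechet) subdifferential at t of a function defined on [0,oo):
    xi such that limsup_{s -> t, s in [0,oo), s <> t}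
      (xi (s - t) - (h s - h t)) / |s - t| <= 0  (written out in eps-delta form). *)
Definition strict_subdiff {R : realType} (h : R -> R) (t : R) : set R :=
  [set xi | forall e : R, 0 < e -> exists d : R, 0 < d /\
    forall s, 0 <= s -> 0 < `|s - t| < d ->
      xi * (s - t) - (h s - h t) <= e * `|s - t|].

(* Main.v *)
(** The inclusion follows from V(s, x) <= g(s) for all s, with equality at s = t.
    As V is an infimum over ordinary controls only, this inequality is a
    relaxation theorem.  Given the relaxed control sigma, cut U into finitely many
    small Borel pieces A_j with nodes c_j and the half-line into cells of length h,
    and let the ordinary control take the value c_j, inside each cell, during a time
    equal to the integral over that cell of sigma(A_j).  Integrals of slowly varying
    functions against the two controls then differ by O(h) plus the oscillation over
    the pieces, uniformly in f; Picard iteration started at the trajectory of sigma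
    yields the trajectory of the ordinary control and the bound on their distance at
    once.  Ordinary controls are handled as Dirac-valued relaxed controls.

    Lower semicontinuity of g: weak-* lower semicontinuity for c and - c makes the
    X-average of the running cost continuous in s for each time tau, and the discount
    dominates the linear growth of the cost, so dominated convergence applies. *)

Require Import Defs.
From HB Require Import structures.
From mathcomp Require Import all_boot all_order all_algebra.
From mathcomp Require Import all_classical all_reals all_analysis.
From mathcomp Require Import measurable_realfun finmap ring lra.
Import Order.TTheory GRing.Theory Num.Theory.
Import numFieldNormedType.Exports.
Local Open Scope classical_set_scope.
Local Open Scope ring_scope.

Set Implicit Arguments.
Unset Strict Implicit.
Unset Printing Implicit Defensive.

(** Trajectories enter as an arbitrary family indexed by f: nothing is known about their
    measurability in f, let alone jointly in f and time. What replaces it is compactness of X.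
    Stability of the differential equation makes f |-> y f continuous on X for the compact-open
    topology, uniformly on bounded times, so X splits into finitely many Borel pieces on which the
    trajectories nearly agree on [0, T]. This makes averages over X measurable in time. Costs are
    averaged over X at each time before any estimate in time, so integrals over time and over X are
    never exchanged. The ordinary control must not depend on f, so a single partition of U has to
    serve all of X. The error bounds do not involve the number of its pieces, because the chosen
    index and the masses of the pieces are both families of convex weights; hence the time step can
    be fixed before the partition. *)

Local Notation halfline R := (`[0%R, +oo[%classic : set R).

(** * Real-valued integrals *)

Section RealIntegral.
Context d (T : measurableType d) (R : realType).
Variable mu : {measure set T -> \bar R}.

Lemma bounded_integrable (D : set T) (f : T -> R) (M : R) :
  measurable D -> (mu D < +oo)%E -> measurable_fun D f ->
  (forall x, D x -> `|f x| <= M) -> mu.-integrable D (EFin \o f).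
Proof.
move=> mD Dfin mf fM; apply: measurable_bounded_integrable => //.
exists M; split; first exact: num_real.
by move=> N MN x Dx; apply: (le_trans (fM _ Dx)); exact: ltW.
Qed.

Lemma normr_Rintegral_le (D : set T) (f g : T -> R) :
  measurable D -> measurable_fun D f ->
  mu.-integrable D (EFin \o g) -> (forall x, D x -> `|f x| <= g x) ->
  `|\int[mu]_(x in D) f x| <= \int[mu]_(x in D) g x.
Proof.
move=> mD mf ig fg.
have intf : mu.-integrable D (EFin \o f).
  apply: le_integrable ig => //; first exact/measurable_EFinP.
  by move=> x Dx /=; rewrite lee_fin (le_trans (fg _ Dx))// ler_norm.
apply: (le_trans (le_normr_Rintegral mD intf)).
by apply: le_Rintegral => //; exact: (integrable_norm intf).
Qed.

Lemma normr_Rintegral_le_cst (D : set T) (f : T -> R) (M : R) :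
  measurable D -> (mu D < +oo)%E -> measurable_fun D f ->
  (forall x, D x -> `|f x| <= M) ->
  `|\int[mu]_(x in D) f x| <= M * fine (mu D).
Proof.
move=> mD Dfin mf fM; rewrite -Rintegral_cst//.
apply: normr_Rintegral_le => //; apply: (bounded_integrable (M := `|M|)) => //.
Qed.

Lemma integrable_sum_ord (D : set T) N (f : nat -> T -> R) :
  measurable D -> (forall j, (j < N)%N -> mu.-integrable D (EFin \o f j)) ->
  mu.-integrable D (EFin \o (fun x => \sum_(j < N) f j x)).
Proof.
move=> mD intf.
rewrite (_ : _ \o _ = (fun x => \sum_(j < N) (EFin \o f j) x)%E); last first.
  by apply/funext => x/=; rewrite sumEFin.
apply: (@integrable_sum _ _ _ mu D mD _ _ _ (fun j : 'I_N => EFin \o f j)) => j _.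
exact: intf.
Qed.

Lemma Rintegral_sum (D : set T) N (f : nat -> T -> R) :
  measurable D -> (forall j, (j < N)%N -> mu.-integrable D (EFin \o f j)) ->
  \int[mu]_(x in D) (\sum_(j < N) f j x) = \sum_(j < N) \int[mu]_(x in D) f j x.
Proof.
move=> mD; elim: N => [|N IH] intf.
  rewrite big_ord0; under eq_Rintegral do rewrite big_ord0.
  by rewrite Rintegral_cst// mul0r.
rewrite big_ord_recr/= -IH; last by move=> j jN; apply: intf; rewrite ltnW.
under eq_Rintegral do rewrite big_ord_recr/=.
rewrite RintegralD//; last exact: intf.
by apply: integrable_sum_ord => // j jN; apply: intf; rewrite ltnW// ltnS.
Qed.

Lemma RintegralN (D : set T) (f : T -> R) : measurable D ->
  mu.-integrable D (EFin \o f) ->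
  \int[mu]_(x in D) (- f x) = - \int[mu]_(x in D) f x.
Proof.
move=> mD intf; rewrite -mulN1r -RintegralZl//.
by apply: eq_Rintegral => x _; rewrite mulN1r.
Qed.

End RealIntegral.

(** * Integrals over intervals and integrals of exponentials *)

Section IntervalIntegral.
Context (R : realType).
Notation mu := (@lebesgue_measure R).

Lemma lebesgue_itv_lty (a b : R) (b0 b1 : bool) :
  (mu [set` Interval (BSide b0 a) (BSide b1 b)] < +oo)%E.
Proof. by rewrite lebesgue_measure_itv/=; case: ifP => // _; rewrite ltey. Qed.

Lemma bounded_itv_integrable (a b M : R) (b0 b1 : bool) (f : R -> R) :
  measurable_fun [set` Interval (BSide b0 a) (BSide b1 b)] f ->
  (forall x, [set` Interval (BSide b0 a) (BSide b1 b)] x -> `|f x| <= M) ->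
  mu.-integrable [set` Interval (BSide b0 a) (BSide b1 b)] (EFin \o f).
Proof.
by move=> mf fM; apply: (bounded_integrable (M := M)) => //; exact: lebesgue_itv_lty.
Qed.

Lemma normr_itv_Rintegral_le (a b M : R) (b0 b1 : bool) (f : R -> R) : a <= b ->
  measurable_fun [set` Interval (BSide b0 a) (BSide b1 b)] f ->
  (forall x, [set` Interval (BSide b0 a) (BSide b1 b)] x -> `|f x| <= M) ->
  `|\int[mu]_(x in [set` Interval (BSide b0 a) (BSide b1 b)]) f x| <= M * (b - a).
Proof.
move=> ab mf fM.
pose D : set R := [set` Interval (BSide b0 a) (BSide b1 b)].
have : `|\int[mu]_(x in D) f x| <= M * fine (mu D).
  apply: normr_Rintegral_le_cst => //; first exact: measurable_itv.
  exact: lebesgue_itv_lty.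
rewrite /D lebesgue_measure_itv/= lte_fin.
case: ltP => // ba; have -> : b = a by apply/eqP; rewrite eq_le ab ba.
by rewrite subrr.
Qed.

Lemma Rintegral_itv_cst (a b r : R) (b0 b1 : bool) : a <= b ->
  \int[mu]_(x in [set` Interval (BSide b0 a) (BSide b1 b)]) r = r * (b - a).
Proof.
move=> ab; pose D : set R := [set` Interval (BSide b0 a) (BSide b1 b)].
have : \int[mu]_(x in D) r = r * fine (mu D).
  by apply: Rintegral_cst; exact: measurable_itv.
rewrite /D => ->; rewrite lebesgue_measure_itv/= lte_fin.
case: ltP => // ba; have -> : b = a by apply/eqP; rewrite eq_le ab ba.
by rewrite subrr.
Qed.

Lemma Rintegral_indic_itv (D : set R) (a b : R) (b0 b1 : bool) : measurable D ->
  a <= b -> [set` Interval (BSide b0 a) (BSide b1 b)] `<=` D ->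
  \int[mu]_(x in D) (\1_[set` Interval (BSide b0 a) (BSide b1 b)] x : R) = b - a.
Proof.
move=> mD ab ID; pose I : set R := [set` Interval (BSide b0 a) (BSide b1 b)].
have : \int[mu]_(x in D) (\1_I x : R) = fine (mu (I `&` D)).
  by rewrite /Rintegral integral_indic//; exact: measurable_itv.
rewrite (setIidl ID) /I => ->; rewrite lebesgue_measure_itv/= lte_fin.
case: ltP => // ba; have -> : b = a by apply/eqP; rewrite eq_le ab ba.
by rewrite subrr.
Qed.

Lemma Rintegral_itv0_split (a b : R) (f : R -> R) : 0 <= a -> a <= b ->
  mu.-integrable `[0, b] (EFin \o f) ->
  \int[mu]_(x in `[0, b]) f x =
  \int[mu]_(x in `[0, a]) f x + \int[mu]_(x in `]a, b]) f x.
Proof.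
move=> a0 ab intf; rewrite -(@Rintegral_itvB _ f (BLeft 0) (BRight b) a)//; first lra.
Qed.

Lemma continuous_expRM (k : R) : continuous (fun s => expR (k * s)).
Proof.
move=> s; apply: continuous_comp; last exact: continuous_expR.
by apply: cvgM; [exact: cvg_cst|exact: cvg_id].
Qed.

Lemma measurable_expRM (k : R) (D : set R) :
  measurable_fun D (fun s => expR (k * s)).
Proof.
apply: measurable_funTS; apply: continuous_measurable_fun.
exact: continuous_expRM.
Qed.

Lemma is_derive_expRM (k x c : R) :
  is_derive x 1 (fun s => c * expR (k * s)) (c * k * expR (k * x)).
Proof.
have -> : (fun s => c * expR (k * s)) = c *: (expR \o (k *: id)).
  by apply/funext => s.
apply: is_derive_eq; rewrite /GRing.scale/= !mulr1/= /GRing.scale/=; ring.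
Qed.

Lemma Rintegral_expRM (k t : R) : 0 < k -> 0 <= t ->
  \int[mu]_(s in `[0, t]) expR (k * s) = k^-1 * (expR (k * t) - 1).
Proof.
move=> k0; rewrite le_eqVlt => /predU1P[<-|t0].
  by rewrite set_itv1 Rintegral_set1 mulr0 expR0 subrr mulr0.
rewrite /Rintegral (@continuous_FTC2 _ _ (fun s => k^-1 * expR (k * s)) 0 t)//=.
- by rewrite mulr0 expR0; ring.
- by apply: continuous_subspaceT; exact: continuous_expRM.
- split.
  + by move=> x _; have [] := is_derive_expRM k x k^-1.
  + apply: cvg_at_right_filter.
    by apply: cvgM; [exact: cvg_cst|exact: continuous_expRM].
  + apply: cvg_at_left_filter.
    by apply: cvgM; [exact: cvg_cst|exact: continuous_expRM].
- move=> x _; rewrite derive1E.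
  have [_ ->] := is_derive_expRM k x k^-1.
  by rewrite mulVf ?mul1r// gt_eqF.
Qed.

(** For a nonnegative integrand the fundamental theorem of calculus on an unbounded interval yields
    a finite value, and finiteness is integrability. The lemma serves both as the dominating
    function of discounted costs and as the estimate of their tails. *)
Lemma Rintegral_expRNM (K c a : R) : 0 <= K -> 0 < c ->
  mu.-integrable `[a, +oo[ (EFin \o (fun s => K * expR (- c * s))) /\
  \int[mu]_(s in `[a, +oo[) (K * expR (- c * s)) = K / c * expR (- c * a).
Proof.
move=> K0 c0.
have e : (\int[mu]_(s in `[a, +oo[) (K * expR (- c * s))%:E =
   0%:E - (- (K / c) * expR (- c * a))%:E)%E.
  apply: (@ge0_continuous_FTC2y _ _ (fun s => - (K / c) * expR (- c * s))).
  - by move=> x _; rewrite mulr_ge0// expR_ge0.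
  - apply: continuous_subspaceT => s.
    by apply: cvgM; [exact: cvg_cst|exact: continuous_expRM].
  - rewrite -[X in _ --> X](mulr0 (- (K / c))); apply: cvgM; first exact: cvg_cst.
    under eq_fun do rewrite mulNr.
    apply: (@cvg_comp _ _ _ (fun s => c * s) (fun s => expR (- s)) _ (+oo)).
      by apply: gt0_cvgMry.
    exact: cvgr_expR.
  - by move=> x _; have [] := is_derive_expRM (- c) x (- (K / c)).
  - apply: cvg_at_right_filter.
    by apply: cvgM; [exact: cvg_cst|exact: continuous_expRM].
  - move=> x _; rewrite derive1E.
    have [_ ->] := is_derive_expRM (- c) x (- (K / c)).
    by rewrite mulrNN divfK// gt_eqF.
have {}e : (\int[mu]_(s in `[a, +oo[) (K * expR (- c * s))%:E =
    (K / c * expR (- c * a))%:E)%E by rewrite e -EFinB; congr EFin; ring.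
split; last by rewrite /Rintegral e.
apply/integrableP; split.
  apply/measurable_EFinP; apply: measurable_funM; first exact: measurable_cst.
  exact: measurable_expRM.
under eq_integral => s _ do
  rewrite /= ger0_norm ?mulr_ge0 ?expR_ge0//.
by rewrite e ltey.
Qed.

End IntervalIntegral.

(** * Finite Borel partitions of compact sets *)

Section CompactPartition.
Context (T : ptopologicalType).

(** Disjointness is asked of all indices and covering of the first [N] only, so the pieces from [N]
    on are empty. A node [c j] lies in [K] but not necessarily in its own piece [A j]. *)
Definition compact_partition (K : set T) (N : nat) (c : nat -> T)
    (A : nat -> set (borel T)) : Prop :=
  [/\ forall j, measurable (A j), forall j, A j `<=` K,
      forall b, K b -> exists2 j, (j < N)%N & A j b,
      forall i j b, A i b -> A j b -> i = j & forall j, K (c j)].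

Lemma open_borel (A : set T) : open A -> measurable (A : set (borel T)).
Proof. by move=> oA; exact: sub_sigma_algebra. Qed.

Lemma closed_borel (A : set T) : closed A -> measurable (A : set (borel T)).
Proof.
move=> cA; rewrite -(setCK A); apply: measurableC.
by apply: open_borel; exact: closed_openC.
Qed.

(** The interiors of the [P]-neighbourhoods cover [K]; a finite subcover is made disjoint by
    removing from each member the earlier ones. *)
Lemma exists_compact_partition (K : set T) (P : T -> T -> Prop) :
  compact K -> closed K -> K !=set0 ->
  (forall a, K a -> nbhs a [set b | K b -> P a b]) ->
  exists N c A, compact_partition K N c A /\ forall j b, A j b -> P (c j) b.
Proof.
move=> cK clK [k0 Kk0] KP.
have : @cover_compact T K by rewrite -compact_cover.
pose O a := interior [set b | K b -> P a b].
have oO a : open (O a) by exact: open_interior.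
have KO : K `<=` cover K O by move=> a Ka; exists a => //; exact: KP.
move=> /(_ _ K O (fun a _ => oO a) KO) [D' D'K KD].
pose s : seq T := enum_fset D'.
have sD a : (a \in s) = (a \in D') by [].
(* The default [k0] belongs to [K], so nodes past the end of the list still lie in [K]. *)
pose c := nth k0 s.
have Kc j : K (c j).
  have [js|js] := ltnP j (size s); last by rewrite /c nth_default.
  by have := mem_nth k0 js; rewrite sD => /D'K /set_mem.
pose A j : set T := K `&` O (c j) `\` \bigcup_(i < j) O (c i).
have AO j b : A j b -> O (c j) b by case=> -[].
exists (size s), c, A; split; last first.
  move=> j b Ab; have Ob := AO _ _ Ab; case: Ab => -[Kb _] _.
  exact: (interior_subset Ob).
split => //.
- move=> j; apply: measurableD.
    by apply: measurableI; [exact: closed_borel|exact: open_borel].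
  by apply: open_borel; apply: bigcup_open.
- by move=> j b [[]].
- move=> b Kb; have [a /= aD Oab] := KD _ Kb.
  have exj : exists j, (j < size s)%N && `[< O (c j) b >].
    exists (index a s); rewrite index_mem sD aD /=; apply/asboolP.
    by rewrite /c nth_index// sD.
  case: (ex_minnP exj) => j /andP[js /asboolP Ojb] jmin.
  exists j => //; split=> // -[i /= ij Oib].
  have := jmin i; rewrite (ltn_trans ij js) => /(_ (introT (asboolP _) Oib)).
  by rewrite leqNgt ij.
- move=> i j b Ai Aj; case: (ltngtP i j) => // ij; exfalso.
    by case: (Aj) => _; apply; exists i => //; exact: AO Ai.
  by case: (Ai) => _; apply; exists j => //; exact: AO Aj.
Qed.

Context (R : realType).

Lemma within_continuous_borel_measurable (K : set T) (k : T -> R) :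
  closed K -> {within K, continuous k} ->
  measurable_fun (K : set (borel T)) k.
Proof.
move=> clK /continuousP ck; apply: (measurability _ (RGenOpens.measurableE R)).
move=> _ [_ [a [b ->] <-]].
have /open_subspaceP [V oV VK] := ck _ (@interval_open R (BRight a) (BLeft b) isT isT).
rewrite setIC -VK; apply: measurableI; first exact: open_borel.
exact: closed_borel.
Qed.

Variable P : probability (borel T) R.

Lemma probability_le1_lty (A : set (borel T)) : measurable A -> (P A < +oo)%E.
Proof.
by move=> mA; rewrite (le_lt_trans (probability_le1 P mA))// ltey.
Qed.

Section fixed_partition.
Context (K : set (borel T)) (N : nat) (c : nat -> T) (A : nat -> set (borel T)).
Hypothesis cA : compact_partition K N c A.
Hypothesis mK : measurable (K : set (borel T)).

Lemma partition_indic_sum (q : nat -> R) j b : (j < N)%N -> A j b ->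
  \sum_(i < N) q i * \1_(A i) b = q j.
Proof.
case: cA => _ _ _ uA _ jN Ajb; rewrite (bigD1 (Ordinal jN))//= big1.
  by rewrite indicE mem_set// mulr1 addr0.
move=> i /eqP ij; rewrite indicE memNset ?mulr0// => Aib; apply: ij.
by apply: val_inj => /=; exact: uA Aib Ajb.
Qed.

Lemma Rintegral_partition (q : nat -> R) :
  \int[P]_(r in K) (\sum_(i < N) q i * \1_(A i) r) =
  \sum_(i < N) q i * fine (P (A i)).
Proof.
case: cA => mA AK _ _ _.
have int1 j : P.-integrable K (EFin \o \1_(A j)).
  apply: (bounded_integrable (M := 1)) => //; first exact: probability_le1_lty.
  by move=> x _; rewrite ger0_norm// indicE lern1; case: (_ \in _).
rewrite (@Rintegral_sum _ _ _ P K N (fun j r => q j * \1_(A j) r))//; last first.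
  by move=> j _; exact: (integrableZl mK (q j) (int1 j)).
apply: eq_bigr => j _; rewrite RintegralZl//; congr (_ * _).
by rewrite /Rintegral integral_indic//; congr (fine (P _)); apply/setIidl/AK.
Qed.

Lemma partition_prob_sum : P K = 1%E -> \sum_(i < N) fine (P (A i)) = 1.
Proof.
move=> PK; case: (cA) => mA AK KA uA _.
rewrite (eq_bigr (fun i : 'I_N => 1 * fine (P (A i)))); last by move=> i; rewrite mul1r.
rewrite -(Rintegral_partition (fun=> 1)).
rewrite (@eq_Rintegral _ _ _ _ _ (cst 1)); last first.
  move=> r /set_mem Kr; have [j jN Aj] := KA _ Kr.
  exact: (partition_indic_sum (fun=> 1) jN Aj).
by rewrite Rintegral_cst// mul1r; exact: (congr1 fine PK).
Qed.

Lemma Rintegral_partition_dist (k : T -> R) (M e : R) :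
  P K = 1%E -> measurable_fun (K : set (borel T)) k ->
  (forall r, K r -> `|k r| <= M) ->
  (forall j r, A j r -> `|k r - k (c j)| <= e) ->
  `|\int[P]_(r in K) k r - \sum_(j < N) k (c j) * fine (P (A j))| <= e.
Proof.
move=> PK mk kM ke; case: (cA) => mA AK KA uA _.
have Koo : (P K < +oo)%E by exact: probability_le1_lty.
have ms : measurable_fun (K : set (borel T)) (fun r => \sum_(i < N) k (c i) * \1_(A i) r : R).
  apply: (@measurable_sum _ (borel T) R K 'I_N _ (fun i r => k (c i) * \1_(A i) r)) => i.
  apply: measurable_funM; first exact: measurable_cst.
  exact: measurable_indic.
have ik : P.-integrable K (EFin \o k) by apply: (bounded_integrable (M := M)).
have sE r : K r -> exists j, (j < N)%N /\ A j r /\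
    \sum_(i < N) k (c i) * \1_(A i) r = k (c j).
  move=> Kr; have [j jN Aj] := KA _ Kr; exists j; split => //; split => //.
  exact: (partition_indic_sum (k \o c) jN Aj).
have M' r : K r -> `|\sum_(i < N) k (c i) * \1_(A i) r| <= M + e.
  move=> Kr; have [j [jN [Aj ->]]] := sE _ Kr.
  have := ke _ _ Aj; have := kM _ Kr; rewrite !ler_norml; lra.
rewrite -(Rintegral_partition (k \o c)) -RintegralB//; last first.
  by apply: (bounded_integrable (M := M + e)).
have Ke : e * fine (P K) = e by rewrite (congr1 fine PK) mulr1.
rewrite -[leRHS]Ke.
apply: normr_Rintegral_le_cst => //; first exact: measurable_funB.
move=> r Kr; have [j [jN [Aj ->]]] := sE _ Kr; exact: ke.
Qed.

End fixed_partition.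
End CompactPartition.

(** * Measurability from uniform approximation on bounded intervals *)

Section MeasurableApprox.
Context (R : realType).

(** Taking error 1/(k+1) on [0, k] gives a sequence of measurable functions converging pointwise.
    Uniformity on bounded intervals is all that partitions by closeness of trajectories can
    provide. *)
Lemma measurable_fun_locally_uniform_approx (h : R -> R) :
  (forall e T : R, 0 < e -> exists g : R -> R, measurable_fun (halfline R) g /\
    forall s, 0 <= s -> s <= T -> `|h s - g s| <= e) ->
  measurable_fun (halfline R) h.
Proof.
move=> H.
have /choice [g gP] : forall k : nat, exists g : R -> R,
    measurable_fun (halfline R) g /\
    forall s, 0 <= s -> s <= k%:R -> `|h s - g s| <= k.+1%:R^-1.
  by move=> k; apply: H; rewrite invr_gt0.
apply: (measurable_fun_cvg (fun k => (gP k).1)) => s /=.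
rewrite in_itv/= andbT => s0; apply/cvgrPdist_le => e e0.
near=> k; apply: (le_trans ((gP k).2 _ s0 _)).
  by near: k; exact: nbhs_infty_ger.
by rewrite ltW//; near: k; exact: near_infty_natSinv_lt (PosNum e0).
Unshelve. all: by end_near. Qed.

(** Measurability of a relaxed control is postulated on sets. A continuous function on a compact set
    is a uniform limit of step functions, whose averages are finite combinations of the masses
    [sigma t (A j)]. *)
Lemma measurable_fun_param_integral (T : ptopologicalType) (K : set T)
    (sigma : R -> probability (borel T) R) (k : T -> R) :
  compact K -> closed K -> K !=set0 ->
  (forall t, 0 <= t -> sigma t K = 1%E) ->
  (forall A : set (borel T), measurable A ->
    measurable_fun (halfline R) (fun t : R => sigma t A)) ->
  {within K, continuous k} -> (exists M, forall r, K r -> `|k r| <= M) ->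
  measurable_fun (halfline R) (fun t => \int[sigma t]_(r in K) k r).
Proof.
move=> cK clK K0 sK ms ck [M kM].
apply: measurable_fun_locally_uniform_approx => e T' e0.
have [|N [c [A [cA Ae]]]] := @exists_compact_partition _ K
    (fun a b => `|k b - k a| <= e) cK clK K0.
  move=> a Ka; have /subspace_continuousP/(_ a Ka) := ck.
  move=> /cvgrPdist_le/(_ e e0); rewrite near_withinE; apply: filterS => b h Kb.
  by rewrite distrC; exact: h.
exists (fun t => \sum_(j < N) k (c j) * fine (sigma t (A j))); split.
  apply: (@measurable_sum _ _ R _ 'I_N _ (fun j t => k (c j) * fine (sigma t (A j)))) => j.
  apply: measurable_funM; first exact: measurable_cst.
  apply: (@measurableT_comp _ _ _ _ _ _ fine) => //; apply: ms.
  by case: cA.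
move=> s s0 _; apply: (Rintegral_partition_dist cA _ (sK _ s0) _ kM) => //.
  exact: closed_borel.
exact: within_continuous_borel_measurable.
Qed.

End MeasurableApprox.

(** * Caratheodory differential equations on the half-line *)

Section RowNorm.
Context (R : realType) (n : nat).

Lemma normr_row_entry (v : 'rV[R]_n) i : `|v ord0 i| <= `|v|.
Proof.
rewrite [leRHS]/Num.norm/= mx_normrE; apply/bigmax_geP; right => /=.
by exists (ord0, i).
Qed.

Lemma normr_row_le (v : 'rV[R]_n) (b : R) :
  0 <= b -> (forall i, `|v ord0 i| <= b) -> `|v| <= b.
Proof.
move=> b0 vb; rewrite [leLHS]/Num.norm/= mx_normrE.
by apply: bigmax_le => //= -[i j] _ /=; rewrite (ord1 i).
Qed.

End RowNorm.

Section HalflineContinuity.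
Context (R : realType) (V : normedModType R).

Lemma within_halflineP (y : R -> V) :
  {within halfline R, continuous y} <->
  forall s : R, 0 <= s -> forall e : R, 0 < e -> exists2 d, 0 < d &
    forall r : R, 0 <= r -> `|s - r| < d -> `|y s - y r| <= e.
Proof.
split=> [/subspace_continuousP cy s s0 e e0|H].
  have Hs : halfline R s by rewrite /= in_itv/= s0.
  have /cvgrPdist_le/(_ e e0) := cy s Hs; rewrite near_withinE.
  move=> /nbhs_ballP[d /= d0 dP]; exists d => // r r0 sr.
  by apply: dP => //=; rewrite in_itv/= r0.
apply/subspace_continuousP => s; rewrite /= in_itv/= andbT => s0.
apply/cvgrPdist_le => e e0; rewrite near_withinE.
have [d d0 dP] := H s s0 e e0.
apply/nbhs_ballP; exists d => //= r sr; rewrite in_itv/= andbT => r0.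
exact: dP.
Qed.

Lemma halfline_lipschitz_continuous (y : R -> V) (C : R) :
  (forall s r : R, 0 <= s -> 0 <= r -> `|y s - y r| <= C * `|s - r|) ->
  {within halfline R, continuous y}.
Proof.
move=> yC; apply/within_halflineP => s s0 e e0.
exists (e / (`|C| + 1)); first by rewrite divr_gt0// ltr_wpDl.
move=> r r0 sr; apply: (le_trans (yC _ _ s0 r0)).
rewrite ltr_pdivlMr ?ltr_wpDl// in sr.
have := ler_norm C; have := normr_ge0 (s - r); nra.
Qed.

(** Sampling the curve at grid points freezes the first argument of [Phi] on each grid cell, where
    measurability is the hypothesis on [Phi z]; the Lipschitz bound and continuity of [y] give
    convergence as the grid is refined. *)
Lemma measurable_caratheodory_comp (Phi : V -> R -> R) (L : R) (y : R -> V) :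
  (forall z, measurable_fun (halfline R) (Phi z)) ->
  (forall z z' (s : R), 0 <= s -> `|Phi z s - Phi z' s| <= L * `|z - z'|) ->
  {within halfline R, continuous y} ->
  measurable_fun (halfline R) (fun s => Phi (y s) s).
Proof.
move=> mPhi lPhi /within_halflineP cy.
(* The last point of the grid of mesh 1/(k+1) not after s. *)
pose r k (s : R) : R := (Num.truncn (s * k.+1%:R))%:R / k.+1%:R.
have k0 k : 0 < k.+1%:R :> R by rewrite ltr0n.
have r0 k s : 0 <= r k s by rewrite divr_ge0.
have rs k s : 0 <= s -> `|s - r k s| < k.+1%:R^-1.
  move=> s0; have s'0 : 0 <= s * k.+1%:R by rewrite mulr_ge0.
  have /andP[h1 h2] := truncn_itv s'0.
  rewrite ger0_norm ?subr_ge0 /r; last by rewrite ler_pdivrMr.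
  rewrite ltrBlDl -[X in _ + X]mul1r -mulrDl ltr_pdivlMr//.
  by rewrite natr1.
have cr s : 0 <= s -> r ^~ s @ \oo --> s.
  move=> s0; apply/cvgrPdist_lt => e e0; near=> k.
  apply: (lt_trans (rs k s s0)).
  by near: k; exact: near_infty_natSinv_lt (PosNum e0).
apply: (measurable_fun_cvg (h := fun k s => Phi (y (r k s)) s)).
- move=> k.
  have -> : halfline R = \bigcup_j (`[j%:R / k.+1%:R, j.+1%:R / k.+1%:R[%classic : set R).
    apply/seteqP; split => s /=; rewrite in_itv/= ?andbT.
      move=> s0; exists (Num.truncn (s * k.+1%:R)) => //=; rewrite in_itv/=.
      have /andP[h1 h2] := truncn_itv (mulr_ge0 s0 (ltW (k0 k))).
      by rewrite ler_pdivrMr// ltr_pdivlMr// h1.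
    by move=> [j _] /=; rewrite in_itv/= => /andP[+ _]; apply: le_trans; rewrite divr_ge0.
  apply/measurable_fun_bigcup => [j|j]; first exact: measurable_itv.
  apply: (@eq_measurable_fun _ _ _ _ _ (Phi (y (j%:R / k.+1%:R)))).
    move=> s /set_mem /=; rewrite in_itv/= => /andP[h1 h2]; rewrite /r.
    rewrite (@truncn_def _ _ j)//; rewrite -ler_pdivrMr// -ltr_pdivlMr//.
    by rewrite h1 h2.
  apply: measurable_funS (mPhi _) => //.
  move=> s /=; rewrite !in_itv/= andbT => /andP[+ _]; apply: le_trans.
  by rewrite divr_ge0.
- move=> s; rewrite /= in_itv/= andbT => s0; apply/cvgrPdist_le => e e0.
  have L0 : 0 < `|L| + 1 by rewrite ltr_wpDl.
  have [d d0 dP] := cy s s0 (e / (`|L| + 1)) (divr_gt0 e0 L0).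
  have /cvgrPdist_lt/(_ d d0) := cr s s0; apply: filterS => k rk.
  apply: (le_trans (lPhi _ _ _ s0)).
  have := dP _ (r0 k s) rk; rewrite ler_pdivlMr//.
  have := ler_norm L; have := normr_ge0 (y s - y (r k s)); nra.
Unshelve. all: by end_near. Qed.

End HalflineContinuity.

(** * Picard iteration and stability of solutions *)

Section CaratheodoryODE.
Context (R : realType) (n : nat).
Notation mu := (@lebesgue_measure R).
Implicit Types (F : 'I_n -> 'rV[R]_n -> R -> R) (x : 'rV[R]_n)
  (y : R -> 'rV[R]_n).

(** The field is given by its components, since the integrals are scalar. The norm of a row is the
    maximum norm, so bounds valid for every component pass to the vector with the same constant. *)
Definition caratheodory_field F (L C : R) : Prop :=
  [/\ forall i z, measurable_fun (halfline R) (F i z),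
      forall i z z' (s : R), 0 <= s -> `|F i z s - F i z' s| <= L * `|z - z'| &
      forall i z (s : R), 0 <= s -> `|F i z s| <= C].

Definition caratheodory_solution F x y : Prop :=
  {within halfline R, continuous y} /\
  forall t, 0 <= t -> forall i,
    y t ord0 i = x ord0 i + \int[mu]_(s in `[0, t]) F i (y s) s.

Lemma le0_geometric (a b : R) : (forall k, a <= b / 2 ^+ k) -> a <= 0.
Proof.
move=> ab; apply/ler_addgt0Pr => e e0; rewrite add0r.
have b1 : 0 < `|b| + 1 by rewrite ltr_wpDl.
have eb : 0 < e / (`|b| + 1) by rewrite divr_gt0.
have [k _ /(_ k (leqnn k)) kP] := near_infty_natSinv_lt (PosNum eb).
apply: (le_trans (ab k)); rewrite ler_pdivrMr ?exprn_gt0//.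
have k2 : k.+1%:R <= 2 ^+ k :> R by rewrite -natrX ler_nat ltn_expl.
move: kP => /= kP; rewrite ltr_pdivlMr// mulrC ltr_pdivrMr// in kP.
by apply: (le_trans (ler_norm b)); nra.
Qed.

(** The explicit rate is the point: every later bound on the solution is read off from its distance
    to the k-th iterate. *)
Lemma geometric_limit (u : nat -> R) (B : R) :
  (forall k, `|u k.+1 - u k| <= B / 2 ^+ k) ->
  exists v, forall k, `|v - u k| <= 2 * B / 2 ^+ k.
Proof.
move=> uB.
have p2 k : B / 2 ^+ k = 2 * (B / 2 ^+ k.+1).
  by rewrite exprS; field; rewrite expf_neq0.
(* Nested intervals: the radius 2B/2^k shrinks by exactly B/2^k, the largest possible move of the
   centre, so [a] increases and [b] decreases. *)
pose a k := u k - 2 * B / 2 ^+ k; pose b k := u k + 2 * B / 2 ^+ k.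
have aS k : a k <= a k.+1.
  by rewrite /a -!mulrA (p2 k); have := uB k; rewrite (p2 k) ler_norml; lra.
have bS k : b k.+1 <= b k.
  by rewrite /b -!mulrA (p2 k); have := uB k; rewrite (p2 k) ler_norml; lra.
have am k l : (k <= l)%N -> a k <= a l by move=> kl; exact: (homo_leq lexx le_trans aS).
have bm k l : (k <= l)%N -> b l <= b k.
  move=> kl; rewrite -lerN2.
  by apply: (@homo_leq _ (fun k => - b k) _ lexx le_trans) => // j; rewrite lerN2.
have B0 k : 0 <= B / 2 ^+ k by exact: le_trans (uB k).
have ab k l : a k <= b l.
  apply: (le_trans (am k (maxn k l) (leq_maxl _ _))).
  apply: (le_trans _ (bm l (maxn k l) (leq_maxr _ _))).
  by rewrite /a /b -!mulrA; have := B0 (maxn k l); lra.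
exists (sup (range a)) => k.
have sa : a k <= sup (range a).
  by apply: ub_le_sup; [exists (b 0%N) => _ [j _ <-]|exists k].
have sb : sup (range a) <= b k.
  by apply: ge_sup; [exists (a 0%N), 0%N|move=> _ [j _ <-]].
by move: sa sb; rewrite /a /b ler_norml; lra.
Qed.

Lemma primitive_lipschitz (f : R -> R) (C s t : R) :
  measurable_fun (halfline R) f -> (forall r : R, 0 <= r -> `|f r| <= C) ->
  0 <= s -> 0 <= t ->
  `|\int[mu]_(r in `[0, s]) f r - \int[mu]_(r in `[0, t]) f r| <= C * `|s - t|.
Proof.
move=> mf fC; wlog st : s t / t <= s.
  move=> H s0 t0; have [ts|/ltW st] := leP t s; first exact: H.
  by rewrite distrC [X in _ * X]distrC; exact: H.
move=> s0 t0.
have ms b a : 0 <= a -> measurable_fun [set` Interval (BSide b a) (BRight s)] f.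
  move=> a0; apply: measurable_funS mf => // r /=; rewrite !in_itv/= andbT.
  by case: b => /= /andP[+ _] => [|/ltW]; exact: le_trans.
have fb b a : 0 <= a -> forall r, [set` Interval (BSide b a) (BRight s)] r -> `|f r| <= C.
  move=> a0 r /=; rewrite in_itv/= => /andP[+ _].
  by case: b => /= => [|/ltW] ar; apply: fC; exact: le_trans ar.
rewrite (Rintegral_itv0_split t0 st); last first.
  by apply: (bounded_itv_integrable (M := C)); [exact: ms|exact: fb].
rewrite addrC addKr [X in _ <= _ * X]ger0_norm ?subr_ge0//.
by apply: normr_itv_Rintegral_le => //; [exact: ms|exact: fb].
Qed.

Section field.
Context F (L C : R) (cF : caratheodory_field F L C) (L0 : 0 < L).

Lemma measurable_field y i : {within halfline R, continuous y} ->
  measurable_fun (halfline R) (fun s => F i (y s) s).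
Proof. by case: cF => mF lF _; exact: (measurable_caratheodory_comp (mF i) (lF i)). Qed.

Lemma measurable_field_itv y i t : {within halfline R, continuous y} ->
  measurable_fun (`[0, t]%classic : set R) (fun s => F i (y s) s).
Proof.
move=> cy; apply: measurable_funS (measurable_field i cy) => //.
by move=> r /=; rewrite !in_itv/= andbT => /andP[].
Qed.

Lemma integrable_field y i t : {within halfline R, continuous y} ->
  mu.-integrable `[0, t] (EFin \o (fun s => F i (y s) s)).
Proof.
move=> cy; apply: (bounded_itv_integrable (M := C)).
  exact: measurable_field_itv.
by case: cF => _ _ FC r; rewrite /= in_itv/= => /andP[r0 _]; exact: FC.
Qed.

Definition picard_step x y (t : R) : 'rV[R]_n :=
  \row_i (x ord0 i + \int[mu]_(s in `[0, t]) F i (y s) s).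

Lemma field_bound_ge0 (i : 'I_n) : 0 <= C.
Proof. by case: cF => _ _ FC; apply: le_trans (FC i 0 0 (lexx 0)). Qed.

(** The absolute value of [C] covers n = 0, where there is no component to force [C] to be
    nonnegative. *)
Lemma picard_step_lipschitz x y (s t : R) : {within halfline R, continuous y} ->
  0 <= s -> 0 <= t -> `|picard_step x y s - picard_step x y t| <= `|C| * `|s - t|.
Proof.
move=> cy s0 t0; apply: normr_row_le => [|i]; first by rewrite mulr_ge0.
rewrite !mxE opprD addrACA subrr add0r.
have C0 := field_bound_ge0 i; rewrite (ger0_norm C0).
apply: primitive_lipschitz => //; first exact: measurable_field.
by case: cF => _ _ FC r r0; exact: FC.
Qed.

Lemma caratheodory_solution_lipschitz x y (s t : R) : caratheodory_solution F x y ->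
  0 <= s -> 0 <= t -> `|y s - y t| <= `|C| * `|s - t|.
Proof.
move=> [cy yE] s0 t0.
have E r : 0 <= r -> y r = picard_step x y r.
  by move=> r0; apply/rowP => i; rewrite mxE yE.
by rewrite !E//; exact: picard_step_lipschitz.
Qed.

(* The weight exp(2Ls) makes the integral operator a contraction of ratio 1/2. *)
Lemma field_integral_contract y y' (M t : R) i :
  {within halfline R, continuous y} -> {within halfline R, continuous y'} ->
  0 <= t -> (forall s, 0 <= s -> s <= t -> `|y s - y' s| <= M * expR (2 * L * s)) ->
  `|\int[mu]_(s in `[0, t]) F i (y s) s - \int[mu]_(s in `[0, t]) F i (y' s) s|
  <= M / 2 * expR (2 * L * t).
Proof.
move=> cy cy' t0 yM.
have M0 : 0 <= M.
  by have := le_trans (normr_ge0 _) (yM 0 (lexx 0) t0); rewrite pmulr_lge0 ?expR_gt0.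
have L2 : 0 < 2 * L by rewrite mulr_gt0.
rewrite -RintegralB//; [|exact: integrable_field..].
have mexp : mu.-integrable `[0, t] (EFin \o (fun s => expR (2 * L * s))).
  apply: (bounded_itv_integrable (M := expR (2 * L * t))).
    exact: measurable_expRM.
  move=> r; rewrite /= in_itv/= => /andP[r0 rt].
  by rewrite ger0_norm ?expR_ge0// ler_expR ler_wpM2l// ltW.
apply: (@le_trans _ _ (\int[mu]_(s in `[0, t]) (L * M * expR (2 * L * s)))).
  apply: normr_Rintegral_le => //.
  - by apply: measurable_funB; exact: measurable_field_itv.
  - by apply: (integrableZl _ (L * M) mexp); exact: measurable_itv.
  - move=> r; rewrite /= in_itv/= => /andP[r0 rt].
    case: cF => _ lF _; apply: (le_trans (lF _ _ _ _ r0)).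
    by rewrite -mulrA; apply: ler_wpM2l; [exact: ltW|exact: yM].
rewrite RintegralZl// Rintegral_expRM//.
have -> : L * M * ((2 * L)^-1 * (expR (2 * L * t) - 1)) = M / 2 * (expR (2 * L * t) - 1).
  by field; rewrite gt_eqF.
by have := expR_gt0 (2 * L * t); nra.
Qed.

End field.

(** Banach's fixed point argument in the norm weighted by exp(-2Lt). The defect of [y0], at most
    [eta] in this norm, is the first increment; with ratio 1/2 the increments sum to 2 [eta], which
    gives existence and the distance to [y0] together. *)
Lemma picard_near_approximate_solution F (L C eta : R) x y0 :
  caratheodory_field F L C -> 0 < L -> 0 <= eta -> {within halfline R, continuous y0} ->
  (forall t, 0 <= t -> forall i,
     `|x ord0 i + \int[mu]_(s in `[0, t]) F i (y0 s) s - y0 t ord0 i|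
     <= eta * expR (2 * L * t)) ->
  exists2 y, caratheodory_solution F x y &
    forall t, 0 <= t -> `|y t - y0 t| <= 2 * eta * expR (2 * L * t).
Proof.
move=> cF L0 eta0 cy0 y0P.
pose u k := iter k (picard_step F x) y0.
have cu k : {within halfline R, continuous (u k)}.
  elim: k => [//|k IH]; apply: (halfline_lipschitz_continuous (C := `|C|)).
  by move=> s r s0 r0; exact: (picard_step_lipschitz cF x IH).
have E0 (t : R) : 0 < expR (2 * L * t) by exact: expR_gt0.
have ud k (t : R) : 0 <= t -> `|u k.+1 t - u k t| <= eta / 2 ^+ k * expR (2 * L * t).
  elim: k t => [|k IH] t t0; apply: normr_row_le => [|i].
  - by rewrite mulr_ge0 ?divr_ge0// ltW.
  - by rewrite expr0 divr1 !mxE; exact: y0P.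
  - by rewrite mulr_ge0 ?divr_ge0 ?exprn_ge0// ltW.
  - rewrite !mxE opprD addrACA subrr add0r.
    have -> : eta / 2 ^+ k.+1 = eta / 2 ^+ k / 2.
      by rewrite exprS; field; rewrite expf_neq0.
    apply: (field_integral_contract cF L0 i (cu k.+1) (cu k) t0) => s s0 st.
    exact: IH.
(* The limit is taken at each time and in each entry separately, which avoids completeness of a
   function space; negative times get the value 0. *)
have /choice [y yP] : forall t : R, exists v : 'rV[R]_n, 0 <= t ->
    forall k, `|v - u k t| <= 2 * eta / 2 ^+ k * expR (2 * L * t).
  move=> t; have [t0|] := boolP (0 <= t); last by exists 0.
  have /choice [w wP] : forall i : 'I_n, exists w : R, forall k,
      `|w - u k t ord0 i| <= 2 * (eta * expR (2 * L * t)) / 2 ^+ k.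
    move=> i; apply: (@geometric_limit (fun k => u k t ord0 i)) => k.
    have := normr_row_entry (u k.+1 t - u k t) i; rewrite !mxE => /le_trans; apply.
    by apply: (le_trans (ud k t t0)); rewrite mulrAC.
  exists (\row_i w i) => _ k; apply: normr_row_le => [|i].
    by rewrite mulr_ge0 ?divr_ge0 ?mulr_ge0 ?exprn_ge0// ltW.
  rewrite !mxE; apply: (le_trans (wP i k)).
  by rewrite !mulrA [X in _ <= X]mulrAC.
have cy : {within halfline R, continuous y}.
  apply: (halfline_lipschitz_continuous (C := `|C|)) => s r s0 r0.
  rewrite -subr_le0.
  apply: (@le0_geometric _ (eta * (expR (2 * L * s) + expR (2 * L * r)))) => k.
  have h1 := yP s s0 k.+1; have h2 := yP r r0 k.+1.
  (* The index is [k.+1] because every Picard step is Lipschitz with constant [|C|], whereas the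
     starting curve [y0] is merely continuous. *)
  have h3 : `|u k.+1 s - u k.+1 r| <= `|C| * `|s - r|.
    exact: (picard_step_lipschitz cF x (cu k)).
  have -> : y s - y r = (y s - u k.+1 s) + (u k.+1 s - u k.+1 r) - (y r - u k.+1 r).
    by rewrite opprB !addrA !subrK.
  have e2 : 2 * eta / 2 ^+ k.+1 = eta / 2 ^+ k.
    by rewrite exprS; field; rewrite expf_neq0.
  rewrite e2 in h1 h2.
  have -> : eta * (expR (2 * L * s) + expR (2 * L * r)) / 2 ^+ k =
    eta / 2 ^+ k * expR (2 * L * s) + eta / 2 ^+ k * expR (2 * L * r).
    by rewrite mulrAC mulrDr.
  rewrite lerBlDr [leRHS]addrAC.
  apply: (le_trans (ler_normB _ _)); apply: lerD => //.
  by apply: (le_trans (ler_normD _ _)); exact: lerD.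
exists y; last first.
  by move=> t t0; have := yP t t0 0%N; rewrite /u /= expr0 divr1.
split => // t t0 i; apply/eqP; rewrite -subr_eq0 -normr_le0.
apply: (@le0_geometric _ (2 * eta * expR (2 * L * t))) => k.
have h1 := le_trans (normr_row_entry _ i) (yP t t0 k.+1).
have h2 : `|\int[mu]_(s in `[0, t]) F i (y s) s - \int[mu]_(s in `[0, t]) F i (u k s) s|
    <= 2 * eta / 2 ^+ k / 2 * expR (2 * L * t).
  apply: (field_integral_contract cF L0 i cy (cu k) t0) => s s0 st; exact: yP.
move: h1 h2; rewrite !mxE -/(u k).
set I := \int[mu]_(_ in _) _; set J := \int[mu]_(_ in _) _.
have e2 : 2 * eta / 2 ^+ k.+1 = eta / 2 ^+ k.
  by rewrite exprS; field; rewrite expf_neq0.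
have e3 : 2 * eta / 2 ^+ k / 2 = eta / 2 ^+ k.
  by field; rewrite expf_neq0.
have e4 : 2 * eta * expR (2 * L * t) / 2 ^+ k = 2 * (eta / 2 ^+ k * expR (2 * L * t)).
  by field; rewrite expf_neq0.
rewrite e2 e3 e4 !ler_norml; lra.
Qed.

(** Gronwall's estimate by bootstrapping. Bounded velocities give the crude distance [K * T]; each
    application of the contraction halves this term, while the term in [zeta] reproduces itself:
    half of 2 zeta T plus the new contribution zeta T. The two fields are compared along [y']
    only. *)
Lemma caratheodory_solution_stability F F' (L C L' C' zeta T : R) x y y' :
  caratheodory_field F L C -> caratheodory_field F' L' C' -> 0 < L -> 0 <= zeta ->
  caratheodory_solution F x y -> caratheodory_solution F' x y' -> 0 <= T ->
  (forall s, 0 <= s -> s <= T -> forall i, `|F i (y' s) s - F' i (y' s) s| <= zeta) ->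
  forall t, 0 <= t -> t <= T -> `|y t - y' t| <= 2 * zeta * T * expR (2 * L * t).
Proof.
move=> cF cF' L0 zeta0 [cy yE] [cy' yE'] T0 FF' t t0 tT.
have E1 (s : R) : 0 <= s -> 1 <= expR (2 * L * s).
  by move=> s0; rewrite -expR0 ler_expR !mulr_ge0// ltW.
pose K : R := 2 * (`|C| + `|C'|).
suff H k s : 0 <= s -> s <= T ->
    `|y s - y' s| <= (2 * zeta * T + K * T / 2 ^+ k) * expR (2 * L * s).
  rewrite -subr_le0; apply: (@le0_geometric _ (K * T * expR (2 * L * t))) => k.
  by have := H k t t0 tT; rewrite mulrDl [_ / _ * _]mulrAC; lra.
elim: k s => [|k IH] s s0 sT.
  have h : `|y s - y' s| <= K * T.
    have h1 := caratheodory_solution_lipschitz cF (conj cy yE) s0 (lexx 0).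
    have h2 := caratheodory_solution_lipschitz cF' (conj cy' yE') s0 (lexx 0).
    have y00 : y 0 = y' 0.
      by apply/rowP => i; rewrite yE// yE'// !set_itv1 !Rintegral_set1.
    have -> : y s - y' s = (y s - y 0) - (y' s - y' 0).
      by rewrite y00 opprB addrA subrK.
    apply: (le_trans (ler_normB _ _)); move: h1 h2; rewrite subr0 (ger0_norm s0).
    have := normr_ge0 C; have := normr_ge0 C'; rewrite /K; nra.
  rewrite expr0 divr1; apply: (le_trans h).
  have K0 : 0 <= K by rewrite mulr_ge0// addr_ge0.
  have := E1 s s0; have : 0 <= K * T by rewrite mulr_ge0.
  have : 0 <= zeta * T by rewrite mulr_ge0.
  nra.
apply: normr_row_le => [|i].
  by rewrite mulr_ge0 ?expR_ge0// addr_ge0 ?divr_ge0 ?mulr_ge0 ?addr_ge0 ?exprn_ge0.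
rewrite !mxE yE// yE'// opprD addrACA subrr add0r.
have h1 := field_integral_contract cF L0 i cy cy' s0
  (fun r r0 rs => IH r r0 (le_trans rs sT)).
have h2 : `|\int[mu]_(r in `[0, s]) F i (y' r) r - \int[mu]_(r in `[0, s]) F' i (y' r) r|
    <= zeta * T.
  rewrite -RintegralB//; [|exact: (integrable_field cF)|exact: (integrable_field cF')].
  apply: (@le_trans _ _ (zeta * (s - 0))); last by rewrite subr0 ler_wpM2l.
  apply: normr_itv_Rintegral_le => //.
    apply: measurable_funB; [exact: (measurable_field_itv cF)|exact: (measurable_field_itv cF')].
  by move=> r; rewrite /= in_itv/= => /andP[r0 rs]; apply: FF' => //; exact: le_trans sT.
have -> : K * T / 2 ^+ k.+1 = K * T / 2 ^+ k / 2.
  by rewrite exprS; field; rewrite expf_neq0.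
move: h1 h2; set I1 := \int[mu]_(_ in _) _; set I2 := \int[mu]_(_ in _) _.
set I3 := \int[mu]_(_ in _) _.
have -> : I1 - I3 = (I1 - I2) + (I2 - I3) by ring.
move=> h1 h2; apply: (le_trans (ler_normD _ _)).
have := E1 s s0; have : 0 <= zeta * T by rewrite mulr_ge0.
move: h1 h2; set E := expR _; set k2 := K * T / _; set a := `|_|; set b := `|_|.
nra.
Qed.

End CaratheodoryODE.

(** * Chattering *)

Section Chattering.
Context (R : realType).
Notation mu := (@lebesgue_measure R).
Context (N : nat) (a : nat -> R -> R) (h : R).
Hypothesis ma : forall j, measurable_fun (halfline R) (a j).
Hypothesis a0 : forall j (s : R), 0 <= s -> 0 <= a j s.
Hypothesis a1 : forall s : R, 0 <= s -> \sum_(j < N) a j s = 1.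
Hypothesis h0 : 0 < h.

Notation cell k := (`[k%:R * h, k.+1%:R * h[%classic : set R).

Let kh_ge0 k : 0 <= k%:R * h. Proof. by rewrite mulr_ge0// ltW. Qed.

Let kh_le k : k%:R * h <= k.+1%:R * h. Proof. by rewrite ler_wpM2r ?ler_nat// ltW. Qed.

Lemma cell_halfline k : cell k `<=` halfline R.
Proof.
by move=> s; rewrite /= !in_itv/= andbT => /andP[+ _]; exact: le_trans.
Qed.

Lemma weight_le1 j (s : R) : (j < N)%N -> 0 <= s -> `|a j s| <= 1.
Proof.
move=> jN s0; rewrite ger0_norm ?a0// -(a1 s0) (bigD1 (Ordinal jN))//= lerDl.
by apply: sumr_ge0 => i _; exact: a0.
Qed.

Lemma integrable_weight_cell j k : (j < N)%N -> mu.-integrable (cell k) (EFin \o a j).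
Proof.
move=> jN; apply: (bounded_itv_integrable (M := 1)).
  by apply: measurable_funS (ma j) => //; exact: cell_halfline.
move=> s /cell_halfline; rewrite /= in_itv/= andbT => s0; exact: weight_le1.
Qed.

(** [w k j] is the time spent on index [j] inside cell [k], and the breakpoints [c k j] stack these
    durations from the left end of the cell. They exhaust it exactly, since the weights sum to 1. *)
Let w k j : R := if (j < N)%N then \int[mu]_(s in cell k) a j s else 0.
Let c k j : R := k%:R * h + \sum_(i < j) w k i.

Let w_ge0 k j : 0 <= w k j.
Proof.
rewrite /w; case: ifP => // _; apply: Rintegral_ge0 => s /cell_halfline.
by rewrite /= in_itv/= andbT => s0; exact: a0.
Qed.

Let cS k j : c k j.+1 = c k j + w k j.
Proof. by rewrite /c big_ord_recr/= addrA. Qed.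

Let c_mono k i j : (i <= j)%N -> c k i <= c k j.
Proof.
by apply: (@homo_leq _ (c k) _ lexx le_trans) => l; rewrite cS lerDl.
Qed.

Let c0 k : c k 0 = k%:R * h. Proof. by rewrite /c big_ord0 addr0. Qed.

Let cN k : c k N = k.+1%:R * h.
Proof.
rewrite /c (eq_bigr (fun i : 'I_N => \int[mu]_(s in cell k) a i s)); last first.
  by move=> i _; rewrite /w ltn_ord.
rewrite -(@Rintegral_sum _ _ _ mu (cell k) N a)//; last first.
  by move=> j jN; exact: integrable_weight_cell.
rewrite (@eq_Rintegral _ _ _ _ _ (cst 1)); last first.
  move=> s /set_mem /cell_halfline /=; rewrite in_itv/= andbT; exact: a1.
by rewrite Rintegral_itv_cst// mul1r addrC subrK.
Qed.

Let piece k j : set R := `[c k j, c k j.+1[%classic.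

Let pieceP s : 0 <= s -> exists k j, (j < N)%N /\ piece k j s.
Proof.
move=> s0; have s'0 : 0 <= s / h by rewrite divr_ge0// ltW.
have /andP[h1 h2] := truncn_itv s'0.
set k := Num.truncn _ in h1 h2; rewrite ler_pdivlMr// in h1; rewrite ltr_pdivrMr// in h2.
(* The least breakpoint beyond [s] closes the half-open piece containing [s]; it is not the first
   one, which is the left end of the cell. *)
have exj : exists j, s < c k j by exists N; rewrite cN.
case: (ex_minnP exj) => -[|j] sj jmin; first by move: sj; rewrite c0 ltNge h1.
exists k, j; split; first by rewrite jmin// cN.
by rewrite /piece/= in_itv/= sj andbT leNgt; apply/negP => /jmin; rewrite ltnn.
Qed.

Let piece_cell k j : (j < N)%N -> piece k j `<=` cell k.
Proof.
move=> jN s; rewrite /piece/= !in_itv/= -cN -(c0 k) => /andP[h1 h2].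
by rewrite (le_trans (c_mono k (leq0n j)) h1) (lt_le_trans h2)// c_mono.
Qed.

Let piece_unique k j k' j' s : (j < N)%N -> (j' < N)%N ->
  piece k j s -> piece k' j' s -> k = k' /\ j = j'.
Proof.
move=> jN j'N ks k's.
have cell_trunc l : cell l s -> Num.truncn (s / h) = l.
  rewrite /= in_itv/= => /andP[h1 h2]; apply: truncn_def.
  by rewrite ler_pdivlMr// h1 ltr_pdivrMr.
have kk' : k = k'.
  by rewrite -(cell_trunc _ (piece_cell jN ks)) -(cell_trunc _ (piece_cell j'N k's)).
split => //; move: ks k's; rewrite -kk' /piece/= !in_itv/= => /andP[h1 h2] /andP[h3 h4].
case: (ltngtP j j') => // jj'; exfalso.
  by have := lt_le_trans h2 (le_trans (c_mono k jj') h3); rewrite ltxx.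
by have := lt_le_trans h4 (le_trans (c_mono k jj') h1); rewrite ltxx.
Qed.

(** [idx s] is the label of the unique piece containing [s]. Inside cell [k] the event [idx s = j]
    is the interval [piece k j], whose length is by construction the integral of [a j] over that
    cell. *)
Lemma exists_chattering_selection : exists idx : R -> nat,
  [/\ forall s, 0 <= s -> (idx s < N)%N,
      forall j, measurable (halfline R `&` [set s | idx s = j]) &
      forall j k, (j < N)%N ->
        \int[mu]_(s in cell k) (idx s == j)%:R = \int[mu]_(s in cell k) a j s].
Proof.
have /choice [idx idxP] : forall s : R, exists j, 0 <= s ->
    (j < N)%N /\ exists k, piece k j s.
  move=> s; have [s0|] := boolP (0 <= s); last by exists 0%N.
  by have [k [j [jN ks]]] := pieceP s0; exists j => _; split => //; exists k.
have idxE s k j : (j < N)%N -> piece k j s -> idx s = j.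
  move=> jN ks; have /cell_halfline/= := piece_cell jN ks.
  rewrite in_itv/= andbT => /idxP[iN [k' k's]].
  by have [] := piece_unique iN jN k's ks.
exists idx; split.
- by move=> s /idxP[].
- move=> j; have [jN|Nj] := ltnP j N; last first.
    rewrite (_ : _ `&` _ = set0)// -subset0 => s /= [].
    by rewrite in_itv/= andbT => /idxP[+ _] => /[swap] ->; rewrite ltnNge Nj.
  rewrite (_ : _ `&` _ = \bigcup_k piece k j).
    by apply: bigcup_measurable => k _; exact: measurable_itv.
  apply/seteqP; split => s.
    by move=> /= []; rewrite in_itv/= andbT => /idxP[_ [k ks]] <-; exists k.
  by move=> [k _ ks]; split; [exact: cell_halfline (piece_cell jN ks)|exact: idxE ks].
- move=> j k jN.
  transitivity (\int[mu]_(s in cell k) (\1_(piece k j) s : R)).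
    apply: eq_Rintegral => s /set_mem ks; rewrite indicE; congr (_%:R); congr nat_of_bool.
    apply/eqP/idP => [e|/set_mem/(idxE _ _ _ jN)//]; apply/mem_set.
    have := cell_halfline ks; rewrite /= in_itv/= andbT => s0.
    have [_ [k' k's]] := idxP _ s0; rewrite e in k's.
    suff -> : k = k' by [].
    have cell_trunc l : cell l s -> Num.truncn (s / h) = l.
      rewrite /= in_itv/= => /andP[h1 h2]; apply: truncn_def.
      by rewrite ler_pdivlMr// h1 ltr_pdivrMr.
    by rewrite -(cell_trunc _ ks) -(cell_trunc _ (piece_cell jN k's)).
  rewrite Rintegral_indic_itv//; last 2 first.
  - by rewrite cS lerDl.
  - exact: piece_cell.
  by rewrite cS addrAC subrr add0r /w jN.
Qed.

Section estimate.
Variable idx : R -> nat.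
Hypothesis idxN : forall s, 0 <= s -> (idx s < N)%N.
Hypothesis midx : forall j, measurable (halfline R `&` [set s | idx s = j]).
Hypothesis idx_cell : forall j k, (j < N)%N ->
  \int[mu]_(s in cell k) (idx s == j)%:R = \int[mu]_(s in cell k) a j s.

Lemma measurable_chattering_indicator j :
  measurable_fun (halfline R) (fun s => (idx s == j)%:R : R).
Proof.
have m1 : measurable_fun (halfline R)
    (\1_(halfline R `&` [set s | idx s = j]) : R -> R).
  by apply: measurable_indic; exact: midx.
apply: eq_measurable_fun m1 => s sH; rewrite indicE in_setI sH/=.
by congr (_%:R); congr nat_of_bool; apply/idP/eqP => [/set_mem//|e]; exact/mem_set.
Qed.

(** Both (idx s == j) and [a j s] are nonnegative and sum to 1 over j, so the absolute coefficients
    sum to at most 2. The bound is thus free of [N]. *)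
Lemma chattering_sum_le (p : nat -> R) (e s : R) : 0 <= s -> 0 <= e ->
  (forall j, (j < N)%N -> `|p j| <= e) ->
  `|\sum_(j < N) ((idx s == j)%:R - a j s) * p j| <= 2 * e.
Proof.
move=> s0 e0 pe; apply: (le_trans (ler_norm_sum _ _ _)).
have -> : 2 * e = \sum_(j < N) ((idx s == j)%:R + a j s) * e.
  rewrite -mulr_suml big_split/= a1// (bigD1 (Ordinal (idxN s0)))//= eqxx big1 ?addr0//.
  move=> i /eqP ij; case: eqP => // e'; exfalso; apply: ij.
  by apply: val_inj.
apply: ler_sum => j _; rewrite normrM; apply: ler_pM => //; last exact: pe.
by apply: (le_trans (ler_normB _ _)); rewrite !ger0_norm ?a0.
Qed.

(** On a complete cell, [q] frozen at the left end integrates to zero against the coefficients,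
    which leaves the oscillation [2 * e] per unit of time. The incomplete last cell is shorter than
    [h] and costs at most [2 * B * h]. *)
Lemma chattering_estimate (q : nat -> R -> R) (t e B : R) :
  0 <= t -> 0 <= e -> 0 <= B -> (forall j, measurable_fun (halfline R) (q j)) ->
  (forall j s, (j < N)%N -> 0 <= s -> s <= t -> `|q j s| <= B) ->
  (forall j s r, (j < N)%N -> 0 <= s -> s <= t -> 0 <= r -> r <= t ->
     `|s - r| <= h -> `|q j s - q j r| <= e) ->
  `|\int[mu]_(s in `[0, t]) \sum_(j < N) ((idx s == j)%:R - a j s) * q j s|
  <= 2 * e * t + 2 * B * h.
Proof.
move=> t0 e0 B0 mq qB qe.
pose G s : R := \sum_(j < N) ((idx s == j)%:R - a j s) * q j s.
have mG : measurable_fun (halfline R) G.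
  apply: (@measurable_sum _ _ R _ 'I_N _
    (fun j s => ((idx s == j)%:R - a j s) * q j s)) => j.
  by apply: measurable_funM => //; apply: measurable_funB => //;
    exact: measurable_chattering_indicator.
have GB s : 0 <= s -> s <= t -> `|G s| <= 2 * B.
  by move=> s0 st; apply: (@chattering_sum_le (fun j => q j s)) => // j jN; exact: qB.
have subH b l r : 0 <= l -> [set` Interval (BSide b l) (BRight r)] `<=` halfline R.
  move=> l0 s /=; rewrite !in_itv/= andbT.
  by case: b => /= /andP[+ _] => [|/ltW]; exact: le_trans.
have intG b l r : 0 <= l -> r <= t ->
    mu.-integrable [set` Interval (BSide b l) (BRight r)] (EFin \o G).
  move=> l0 rt; apply: (bounded_itv_integrable (M := 2 * B)).
    by apply: measurable_funS mG => //; exact: subH.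
  move=> s sI; have := subH _ _ _ l0 _ sI; rewrite /= in_itv/= andbT => s0.
  apply: GB => //; move: sI; rewrite /= in_itv/= => /andP[_ sr].
  exact: le_trans rt.
have GS k : k.+1%:R * h <= t -> `|\int[mu]_(s in `]k%:R * h, k.+1%:R * h]) G s| <= 2 * e * h.
  move=> kt.
  have ksub : cell k `<=` (`[0, t]%classic : set R).
    move=> s; rewrite /= !in_itv/= => /andP[h1 h2].
    by rewrite (le_trans _ h1)//= ltW// (lt_le_trans h2).
  have intGc : mu.-integrable (cell k) (EFin \o G).
    apply: (bounded_itv_integrable (M := 2 * B)).
      by apply: measurable_funS mG => //; exact: cell_halfline.
    by move=> s /ksub/=; rewrite in_itv/= => /andP[s0 st]; exact: GB.
  (* Splitting [0, t] produces left-open intervals, while the cells are right-open; the endpoints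
     are negligible. *)
  rewrite (Rintegral_itv_obnd_cbnd (intG _ _ _ (kh_ge0 k) kt)) -(Rintegral_itv_bndo_bndc intGc).
  (* [Z] is the integrand with [q] frozen at the left end of the cell; its integral over the cell
     vanishes by [idx_cell]. *)
  pose Z s : R := \sum_(j < N) q j (k%:R * h) * ((idx s == j)%:R - a j s).
  have intx j : (j < N)%N -> mu.-integrable (cell k) (EFin \o (fun s => (idx s == j)%:R : R)).
    move=> jN; apply: (bounded_itv_integrable (M := 1)).
      by apply: measurable_funS (measurable_chattering_indicator j) => //; exact: cell_halfline.
    by move=> s _; rewrite ger0_norm// lern1; case: eqP.
  have intd j : (j < N)%N ->
      mu.-integrable (cell k) (EFin \o (fun s => (idx s == j)%:R - a j s)).
    move=> jN; apply: (bounded_itv_integrable (M := 2)).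
      apply: measurable_funB.
        by apply: measurable_funS (measurable_chattering_indicator j) => //; exact: cell_halfline.
      by apply: measurable_funS (ma j) => //; exact: cell_halfline.
    move=> s /cell_halfline; rewrite /= in_itv/= andbT => s0.
    apply: (le_trans (ler_normB _ _)).
    have := weight_le1 jN s0; have : `|(idx s == j)%:R| <= 1 :> R.
      by rewrite ger0_norm// lern1; case: eqP.
    lra.
  have ZE : \int[mu]_(s in cell k) Z s = 0.
    rewrite /Z (@Rintegral_sum _ _ _ mu (cell k) N
      (fun j s => q j (k%:R * h) * ((idx s == j)%:R - a j s)))//; last first.
      by move=> j jN; apply: (integrableZl _ (q j (k%:R * h)) (intd j jN)); exact: measurable_itv.
    apply: big1 => j _; rewrite RintegralZl//; last exact: intd.
    rewrite RintegralB//; [|exact: intx|exact: integrable_weight_cell].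
    by rewrite idx_cell// subrr mulr0.
  have intZ : mu.-integrable (cell k) (EFin \o Z).
    apply: (@integrable_sum_ord _ _ _ mu (cell k) N
      (fun j s => q j (k%:R * h) * ((idx s == j)%:R - a j s))) => // j jN.
    by apply: (integrableZl _ (q j (k%:R * h)) (intd j jN)); exact: measurable_itv.
  rewrite -[X in `|X|]subr0 -ZE -RintegralB//.
  have -> : 2 * e * h = 2 * e * (k.+1%:R * h - k%:R * h).
    by rewrite -natr1; ring.
  apply: normr_itv_Rintegral_le => //.
    apply: measurable_funB; apply/measurable_EFinP.
      by case/integrableP: intGc.
    by case/integrableP: intZ.
  move=> s sk; have := ksub _ sk; rewrite /= in_itv/= => /andP[s0 st].
  have -> : G s - Z s = \sum_(j < N) ((idx s == j)%:R - a j s) * (q j s - q j (k%:R * h)).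
    by rewrite -sumrB; apply: eq_bigr => j _; ring.
  apply: (@chattering_sum_le (fun j => q j s - q j (k%:R * h))) => // j jN; apply: qe => //.
    by rewrite (le_trans _ kt).
  move: sk; rewrite /= in_itv/= => /andP[h1 h2].
  rewrite ger0_norm ?subr_ge0// lerBlDl ltW// (lt_le_trans h2)//.
  by rewrite -natr1 mulrDl mul1r.
have GK k : k%:R * h <= t -> `|\int[mu]_(s in `[0, k%:R * h]) G s| <= 2 * e * (k%:R * h).
  elim: k => [|k IH] kt; first by rewrite mul0r set_itv1 Rintegral_set1 normr0 mulr0.
  have kt' := le_trans (kh_le k) kt.
  rewrite (Rintegral_itv0_split (kh_ge0 k) (kh_le k)); last exact: intG.
  apply: (le_trans (ler_normD _ _)).
  have := IH kt'; have := GS k kt; rewrite -natr1 mulrDl mul1r; lra.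
have t'0 : 0 <= t / h by rewrite divr_ge0// ltW.
have /andP[h1 h2] := truncn_itv t'0.
set K := Num.truncn _ in h1 h2; rewrite ler_pdivlMr// in h1; rewrite ltr_pdivrMr// in h2.
rewrite -/G -[X in Rintegral _ _ X]/G (Rintegral_itv0_split (kh_ge0 K) h1); last exact: intG.
apply: (le_trans (ler_normD _ _)); apply: lerD.
  by apply: (le_trans (GK K h1)); rewrite ler_wpM2l// mulr_ge0.
apply: (@le_trans _ _ (2 * B * (t - K%:R * h))); last first.
  rewrite ler_wpM2l ?mulr_ge0// lerBlDl ltW// (lt_le_trans h2)//.
  by rewrite -natr1 mulrDl mul1r.
apply: normr_itv_Rintegral_le => //.
  by apply: measurable_funS mG => //; exact: subH.
move=> s sI; have := subH _ _ _ (kh_ge0 K) _ sI; rewrite /= in_itv/= andbT => s0.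
by apply: GB => //; move: sI; rewrite /= in_itv/= => /andP[].
Qed.

End estimate.
End Chattering.

(** * Relaxed controls and their trajectories *)

Section EuclideanNorm.
Context (R : realType) (k : nat).
Implicit Types v : 'rV[R]_k.

Lemma normr_entry_enorm v i : `|v ord0 i| <= enorm v.
Proof.
rewrite /enorm -sqrtr_sqr; apply: ler_wsqrtr.
by rewrite (bigD1 i)//= lerDl; apply: sumr_ge0 => j _; exact: sqr_ge0.
Qed.

(** The factor k replaces the sharp square root of k; only some finite constant matters. *)
Lemma enorm_le_normr v : enorm v <= k%:R * `|v|.
Proof.
rewrite /enorm -[leRHS]ger0_norm ?mulr_ge0// -sqrtr_sqr; apply: ler_wsqrtr.
apply: (@le_trans _ _ (\sum_(i < k) `|v| ^+ 2)).
  apply: ler_sum => i _; rewrite -[_ ^+ 2]ger0_norm ?sqr_ge0// normrX.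
  by rewrite ler_pXn2r ?nnegrE//; exact: normr_row_entry.
rewrite sumr_const card_ord -[leLHS]mulr_natl exprMn ler_wpM2r ?sqr_ge0//.
by rewrite -natrX ler_nat; case: k => // n; rewrite expnS expn1 leq_pmulr.
Qed.

Lemma enorm_ge0 v : 0 <= enorm v.
Proof. exact: sqrtr_ge0. Qed.

End EuclideanNorm.

(** * Topology of the control set and of the space of vector fields *)

Section CompactDomain.
Context (R : realType) (n m : nat) (U : set 'rV[R]_m).
Hypothesis cU : compact U.

Lemma row_hausdorff k : hausdorff_space 'rV[R]_k.
Proof. exact: norm_hausdorff. Qed.

Lemma closed_domain : closed U.
Proof. by apply: compact_closed => //; exact: row_hausdorff. Qed.

(** A filter on the subtype is pushed to R^m by [val], where it clusters at a point of [U];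
    neighbourhoods in the subtype are traces of neighbourhoods in R^m, so the cluster point
    lifts. *)
Lemma set_type_compact : compact [set: set_type U].
Proof.
move=> F PF _.
pose G : set_system 'rV[R]_m := val @ F.
have GU : G U by apply: (@filterS _ F _ setT) (@filterT _ F _) => u _; exact: set_valP.
have [p [Up Gp]] := cU (F := G) _ GU.
exists (SigSub (mem_set Up)); split => // A B FA.
rewrite /nbhs/= => -[V [[W oW WV] Vp VB]].
have [||q [[u Au <-] Wu]] := Gp (val @` A) W.
- by apply: (@filterS _ F _ A) => // u Au; exists u.
- apply: open_nbhs_nbhs; split => //.
  by move: Vp; rewrite -WV.
by exists u; split => //; apply: VB; rewrite -WV.
Qed.

Lemma closed_ball_compact k (x : 'rV[R]_k) (r : R) : compact [set z : 'rV[R]_k | `|x - z| <= r].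
Proof.
apply: bounded_closed_compact; last exact: closed_closed_ball_.
exists (`|x| + r); split; first exact: num_real.
move=> M xM z /= zx; apply: (le_trans _ (ltW xM)).
by rewrite -[z](subrK x) addrC (le_trans (ler_normD _ _))// lerD2l distrC.
Qed.

Lemma extU_val (h : set_type U -> R) (u : set_type U) : extU h (val u) = h u.
Proof.
rewrite /extU; case: pselect => [Uu|]; last by case; exact: set_valP.
by congr h; apply: val_inj.
Qed.

Lemma extU_ex (r : 'rV[R]_m) : U r -> exists u : set_type U, r = val u.
Proof. by move=> Ur; exists (SigSub (mem_set Ur)). Qed.

Lemma continuous_extU (h : set_type U -> R) : continuous h -> {within U, continuous (extU h)}.
Proof.
move=> ch; apply/subspace_sigL_continuousP.
by have -> : sigL U (extU h) = h by apply/funext => u; rewrite /sigL/= extU_val.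
Qed.

Lemma lipschitz_extU (h : set_type U -> R) (K : R) :
  (forall u u', `|h u - h u'| <= K * `|val u - val u'|) ->
  {within U, continuous (extU h)}.
Proof.
move=> hK; apply/subspace_continuousP => a Ua.
apply/cvgrPdist_le => e e0; rewrite near_withinE.
have K1 : 0 < `|K| + 1 by rewrite ltr_wpDl.
apply/nbhs_ballP; exists (e / (`|K| + 1)); first exact: divr_gt0.
move=> b; rewrite -ball_normE/= => ab Ub.
have [u uE] := extU_ex Ua; have [u' uE'] := extU_ex Ub.
rewrite /from_subspace uE uE' !extU_val; apply: (le_trans (hK _ _)).
rewrite -uE -uE'; rewrite ltr_pdivlMr// in ab.
have := ler_norm K; have := normr_ge0 (a - b); nra.
Qed.

(* The compact-open type [FT n U] carries no canonical pointed topological structure,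
   which Borel sigma-algebras require; only the packaging differs from [FT n U]. *)
Definition FT_pointed : ptopologicalType :=
  HB.pack_for ptopologicalType (FT n U)
    (Uniform.class ({family compact, dom n U -> 'rV[R]_n} : uniformType))
    (isPointed.Build (FT n U) (point : dom n U -> 'rV[R]_n)).

Definition as_pointed (P : probability (borel (FT n U)) R) :
  probability (borel FT_pointed) R := P.

Lemma Rintegral_as_pointed (P : probability (borel (FT n U)) R) (X : set (FT n U))
    (g : FT n U -> R) :
  \int[as_pointed P]_(f in X) g f = \int[P]_(f in X) g f.
Proof. by []. Qed.

Lemma FT_nbhs (f : FT n U) (A : set (dom n U)) (e : R) : compact A -> 0 < e ->
  nbhs f [set g : FT n U | forall p, A p -> `|f p - g p| < e].
Proof.
move=> cA e0.
have := @fam_nbhs _ _ compact A [set p : 'rV[R]_n * 'rV[R]_n | ball p.1 e p.2] f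
  (entourage_ball _ (PosNum e0)) cA.
by apply: filterS => g /= gP p Ap; have := gP p Ap; rewrite -ball_normE.
Qed.

(** Singletons are compact, so functions are already separated by their value at one point.
    Hausdorffness makes the compact set X closed, hence Borel. *)
Lemma FT_hausdorff : hausdorff_space FT_pointed.
Proof.
move=> f g fg; apply/funext => p; apply/eqP; rewrite -subr_eq0 -normr_le0.
apply/ler_addgt0Pr => e e0; rewrite add0r.
have e2 : 0 < e / 2 by rewrite divr_gt0.
have c1 : compact [set p] by exact: compact_set1.
have [h [/= /(_ p erefl) h1 /(_ p erefl) h2]] := fg _ _ (FT_nbhs f c1 e2) (FT_nbhs g c1 e2).
have -> : f p - g p = (f p - h p) - (g p - h p) by rewrite opprB addrA subrK.
by apply: (le_trans (ler_normB _ _)); lra.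
Qed.

Lemma FT_compact_closed (X : set (FT n U)) : compact X -> @closed FT_pointed X.
Proof. by move=> cX; apply: compact_closed => //; exact: FT_hausdorff. Qed.

End CompactDomain.

(** * Averages against a relaxed control *)

Section RelaxedAverage.
Context (R : realType) (m : nat) (U : set 'rV[R]_m).
Hypothesis cU : compact U.
Context (sigma : R -> probability (borel 'rV[R]_m) R).
Hypothesis rsigma : relaxed_control U sigma.
Implicit Types h : set_type U -> R.

Definition relaxed_average h (t : R) : R := \int[sigma t]_(r in U) extU h r.

Lemma domain_nonempty : U !=set0.
Proof.
apply/set0P/eqP => U0; case: rsigma => /(_ 0 (lexx 0)) + _.
by rewrite U0 measure0 => /eqP; rewrite eq_sym onee_eq0.
Qed.

Lemma domain_measurable : measurable (U : set (borel 'rV[R]_m)).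
Proof. exact: (closed_borel (closed_domain cU)). Qed.

Lemma extU_measurable h : {within U, continuous (extU h)} ->
  measurable_fun (U : set (borel 'rV[R]_m)) (extU h).
Proof. by move=> ch; apply: within_continuous_borel_measurable => //; exact: closed_domain. Qed.

Lemma extU_bounded h : {within U, continuous (extU h)} ->
  exists M, forall r, U r -> `|extU h r| <= M.
Proof.
move=> ch; have := compact_bounded (continuous_compact ch cU).
move=> [M [_ HM]]; exists (M + 1) => r Ur.
by apply: (HM (M + 1)); [rewrite ltrDl|exists r].
Qed.

Lemma extU_integrable h t : {within U, continuous (extU h)} ->
  (sigma t).-integrable U (EFin \o (extU h : borel 'rV[R]_m -> R)).
Proof.
move=> ch; have [M hM] := extU_bounded ch.
apply: (bounded_integrable (M := M)) => //; first exact: domain_measurable.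
  by apply: probability_le1_lty; exact: domain_measurable.
exact: extU_measurable.
Qed.

Lemma relaxed_average_measurable h : {within U, continuous (extU h)} ->
  measurable_fun (halfline R) (relaxed_average h).
Proof.
move=> ch; case: rsigma => sU ms; apply: measurable_fun_param_integral => //.
- exact: closed_domain.
- exact: domain_nonempty.
- exact: extU_bounded.
Qed.

Lemma relaxed_average_bound h (t M : R) : 0 <= t -> {within U, continuous (extU h)} ->
  (forall u, `|h u| <= M) -> `|relaxed_average h t| <= M.
Proof.
move=> t0 ch hM; case: rsigma => sU _.
have E : M * fine (sigma t U) = M by rewrite (congr1 fine (sU t t0)) mulr1.
rewrite -[leRHS]E; apply: normr_Rintegral_le_cst; first exact: domain_measurable.
- by apply: probability_le1_lty; exact: domain_measurable.
- exact: extU_measurable.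
- by move=> r Ur; have [u ->] := extU_ex Ur; rewrite extU_val.
Qed.

Lemma relaxed_average_dist h h' (t M : R) : 0 <= t ->
  {within U, continuous (extU h)} -> {within U, continuous (extU h')} ->
  (forall u, `|h u - h' u| <= M) -> `|relaxed_average h t - relaxed_average h' t| <= M.
Proof.
move=> t0 ch ch' hM; case: rsigma => sU _.
have mU := domain_measurable.
rewrite /relaxed_average -RintegralB//; [|exact: extU_integrable..].
have E : M * fine (sigma t U) = M by rewrite (congr1 fine (sU t t0)) mulr1.
rewrite -[leRHS]E; apply: normr_Rintegral_le_cst => //.
- exact: probability_le1_lty.
- by apply: measurable_funB; exact: extU_measurable.
- by move=> r Ur; have [u ->] := extU_ex Ur; rewrite !extU_val.
Qed.

Lemma relaxed_average_partition N c A h (t e : R) : 0 <= t ->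
  compact_partition U N c A -> {within U, continuous (extU h)} ->
  (forall j r, A j r -> `|extU h r - extU h (c j)| <= e) ->
  `|relaxed_average h t - \sum_(j < N) extU h (c j) * fine (sigma t (A j))| <= e.
Proof.
move=> t0 cA ch he; case: rsigma => sU _; have [M hM] := extU_bounded ch.
apply: (Rintegral_partition_dist cA _ _ _ hM) => //.
- exact: domain_measurable.
- exact: sU.
- exact: extU_measurable.
Qed.

End RelaxedAverage.

Section DiracControl.
Context (R : realType) (m : nat) (U : set 'rV[R]_m).
Hypothesis cU : compact U.
Context (u : R -> set_type U).

Definition dirac_control (t : R) : probability (borel 'rV[R]_m) R :=
  \d_(val (u t) : borel 'rV[R]_m).

Lemma dirac_relaxed_control : ordinary_control u -> relaxed_control U dirac_control.
Proof.
move=> ou; split=> [t t0|A mA].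
  by rewrite /dirac_control/= diracE mem_set//; exact: set_valP.
have mu : measurable_fun (halfline R) (fun t => val (u t) : borel 'rV[R]_m).
  apply: (@measurability _ _ _ (borel 'rV[R]_m) _ _ (@open 'rV[R]_m)) => //.
  by move=> _ [B oB <-]; exact: ou.
exact: (measurableT_comp (measurable_fun_dirac mA) mu).
Qed.

Lemma relaxed_average_dirac h t : 0 <= t -> {within U, continuous (extU h)} ->
  relaxed_average dirac_control h t = h (u t).
Proof.
move=> t0 ch; rewrite /relaxed_average /Rintegral.
rewrite (@integral_dirac _ _ _ _ _ (domain_measurable cU)); last first.
  by apply/measurable_EFinP; exact: extU_measurable.
by rewrite diracE mem_set ?mul1e ?extU_val//; exact: set_valP.
Qed.

End DiracControl.

(** * Trajectories and running costs of a relaxed control *)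

Section RelaxedTrajectories.
Context (R : realType) (n m : nat) (U : set 'rV[R]_m) (X : set (FT n U)).
Context (L C LJ lambda : R) (J : dom n U -> R) (x : 'rV[R]_n).
Hypothesis cU : compact U.
Hypothesis hX : H1 X L C.
Hypothesis hJ : H2 J LJ.
Hypothesis lambda0 : 0 < lambda.
Notation mu := (@lebesgue_measure R).
(** Passing from the Euclidean to the maximum norm costs the factor n. The added 1 makes the
    constant positive even for n = 0, and at least 1, which later gives t <= exp(2Kt). *)
Notation K := (n%:R * L + 1).

Let L0 : 0 < L. Proof. by case: hX => _ [_ []]. Qed.
Let C0 : 0 < C. Proof. by case: hX => _ [_ [_ []]]. Qed.

Lemma field_constant_gt0 : 0 < K.
Proof. by rewrite ltr_wpDl// mulr_ge0// ltW. Qed.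

Lemma field_entry_lipschitz f i z z' (u u' : set_type U) : X f ->
  `|f (z, u) ord0 i - f (z', u') ord0 i| <=
  L * (n%:R * `|z - z'| + m%:R * `|val u - val u'|).
Proof.
move=> Xf; case: hX => _ [_ [_ [_ [fL _]]]].
have := normr_entry_enorm (f (z, u) - f (z', u')) i; rewrite !mxE => /le_trans; apply.
apply: (le_trans (fL f Xf z z' u u')); apply: ler_wpM2l; first exact: ltW.
by apply: lerD; exact: enorm_le_normr.
Qed.

Lemma field_entry_bound f i z (u : set_type U) : X f -> `|f (z, u) ord0 i| <= C.
Proof.
move=> Xf; case: hX => _ [_ [_ [_ [_ fC]]]].
exact: le_trans (normr_entry_enorm _ _) (fC f Xf z u).
Qed.

Lemma field_extU_continuous f i z : X f ->
  {within U, continuous (extU (fun r => f (z, r) ord0 i))}.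
Proof.
move=> Xf; apply: (@lipschitz_extU _ _ _ _ (L * m%:R)) => u u'.
by have := field_entry_lipschitz i z z u u' Xf; rewrite subrr normr0 mulr0 add0r mulrA.
Qed.

Lemma cost_extU_continuous z : {within U, continuous (extU (fun r => J (z, r)))}.
Proof.
apply: continuous_extU => u; case: hJ => cJ _.
apply: (@continuous_comp _ _ _ (fun r => (z, r)) J); last exact: cJ.
move=> W [[A B] [/= zA uB] AB]; apply: (@filterS _ (nbhs u) _ B) => // r Br.
by apply: AB; split => //=; exact: nbhs_singleton zA.
Qed.

Lemma cost_lipschitz z z' (u : set_type U) :
  `|J (z, u) - J (z', u)| <= `|LJ| * n%:R * `|z - z'|.
Proof.
case: hJ => _ JL; apply: (le_trans (JL z z' u)).
apply: (@le_trans _ _ (`|LJ| * enorm (z - z'))).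
  by rewrite ler_wpM2r ?enorm_ge0// ler_norm.
by rewrite -mulrA ler_wpM2l// enorm_le_normr.
Qed.

Lemma cost_bound : exists2 A, 0 <= A & forall u : set_type U, `|J (x, u)| <= A.
Proof.
have [A HA] := extU_bounded cU (@cost_extU_continuous x).
exists `|A| => // u; have := HA _ (set_valP u); rewrite extU_val => /le_trans; apply.
exact: ler_norm.
Qed.

Section control.
Context (sigma : R -> probability (borel 'rV[R]_m) R) (y : FT n U -> R -> 'rV[R]_n).
Hypothesis rsigma : relaxed_control U sigma.

Definition relaxed_field (f : FT n U) (i : 'I_n) (z : 'rV[R]_n) (t : R) : R :=
  relaxed_average sigma (fun r : set_type U => f (z, r) ord0 i) t.

Lemma relaxed_field_caratheodory f : X f -> caratheodory_field (relaxed_field f) K C.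
Proof.
move=> Xf; split=> [i z|i z z' s s0|i z s s0].
- by apply: relaxed_average_measurable => //; exact: field_extU_continuous.
- apply: (relaxed_average_dist cU rsigma s0); [exact: field_extU_continuous..|].
  move=> u; have := field_entry_lipschitz i z z' u u Xf.
  rewrite subrr normr0 mulr0 addr0 => /le_trans; apply.
  by rewrite mulrA [L * _]mulrC mulrDl mul1r lerDl.
- apply: (relaxed_average_bound cU rsigma s0); first exact: field_extU_continuous.
  by move=> u; exact: field_entry_bound.
Qed.

Hypothesis ry : relaxed_traj X sigma x y.

Lemma relaxed_traj_solution f : X f -> caratheodory_solution (relaxed_field f) x (y f).
Proof. by move=> /ry. Qed.

Lemma relaxed_traj_lipschitz f (s t : R) : X f -> 0 <= s -> 0 <= t ->
  `|y f s - y f t| <= C * `|s - t|.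
Proof.
move=> Xf s0 t0; rewrite -[X in X * _](ger0_norm (ltW C0)).
by have := caratheodory_solution_lipschitz (relaxed_field_caratheodory Xf)
  (relaxed_traj_solution Xf) s0 t0.
Qed.

Lemma relaxed_traj_dist_start f (t : R) : X f -> 0 <= t -> `|x - y f t| <= C * t.
Proof.
move=> Xf t0.
have y0 : y f 0 = x.
  by apply/rowP => i; rewrite (relaxed_traj_solution Xf).2// set_itv1 Rintegral_set1 addr0.
have := relaxed_traj_lipschitz Xf (lexx 0) t0; rewrite y0 => /le_trans; apply.
by rewrite sub0r normrN ger0_norm.
Qed.

(** Up to time [T] trajectories stay within distance [C * T] of [x], so closeness of f to f0 on the
    compact set [B] is enough for the stability estimate. *)
Lemma relaxed_traj_continuous f0 (T e : R) : X f0 -> 0 <= T -> 0 < e ->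
  nbhs f0 [set f : FT n U | X f ->
    forall t : R, 0 <= t -> t <= T -> `|y f t - y f0 t| <= e].
Proof.
move=> Xf0 T0 e0; pose E := expR (2 * K * T).
have E0 : 0 < E by exact: expR_gt0.
(* Stability gives the bound 2 zeta T E, which this choice keeps below [e]; the added 1 keeps the
   denominator positive when T = 0. *)
pose zeta := e / ((2 * T + 1) * E).
have zeta0 : 0 < zeta by rewrite divr_gt0// mulr_gt0// ltr_wpDl// mulr_ge0.
pose B : set (dom n U) := [set z : 'rV[R]_n | `|x - z| <= C * T] `*` [set: set_type U].
have cB : compact B.
  by apply: compact_setX; [exact: closed_ball_compact|exact: set_type_compact].
apply: filterS (FT_nbhs f0 cB zeta0) => f /= fB Xf t t0 tT.
have H := caratheodory_solution_stability (relaxed_field_caratheodory Xf)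
  (relaxed_field_caratheodory Xf0) field_constant_gt0 (ltW zeta0)
  (relaxed_traj_solution Xf) (relaxed_traj_solution Xf0) T0.
apply: (le_trans (H _ _ t0 tT)).
  move=> s s0 sT i.
  apply: (relaxed_average_dist cU rsigma s0); [exact: field_extU_continuous..|].
  move=> u; have := fB (y f0 s, u); rewrite /B/=.
  have ysT : `|x - y f0 s| <= C * T.
    by apply: (le_trans (relaxed_traj_dist_start Xf0 s0)); rewrite ler_wpM2l// ltW.
  move=> /(_ (conj ysT Logic.I)) /ltW; apply: le_trans.
  by have := normr_row_entry (f0 (y f0 s, u) - f (y f0 s, u)) i; rewrite !mxE distrC.
apply: (@le_trans _ _ (2 * zeta * T * E)).
  apply: ler_wpM2l; first by apply: mulr_ge0 => //; apply: mulr_ge0 => //; exact: ltW.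
  rewrite /E ler_expR ler_wpM2l// mulr_ge0//; exact: ltW field_constant_gt0.
rewrite /zeta [leLHS](_ : _ = e * (2 * T / (2 * T + 1))).
  rewrite ger_pMr// ler_pdivrMr ?mul1r ?lerDl// ltr_wpDl// mulr_ge0//.
by field; rewrite !gt_eqF//= ltr_wpDl// mulr_ge0.
Qed.

Definition cost_rate (z : 'rV[R]_n) (t : R) : R :=
  expR (- lambda * t) * relaxed_average sigma (fun r : set_type U => J (z, r)) t.

Lemma discount_le1 (t : R) : 0 <= t -> 0 <= expR (- lambda * t) <= 1.
Proof.
move=> t0; rewrite expR_ge0/= -expR0 ler_expR mulNr oppr_le0 mulr_ge0//.
exact: ltW.
Qed.

Lemma cost_rate_lipschitz z z' (t : R) : 0 <= t ->
  `|cost_rate z t - cost_rate z' t| <= `|LJ| * n%:R * `|z - z'|.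
Proof.
move=> t0; have /andP[d0 d1] := discount_le1 t0.
rewrite -mulrBr normrM (ger0_norm d0).
have h : `|relaxed_average sigma (fun r : set_type U => J (z, r)) t -
    relaxed_average sigma (fun r : set_type U => J (z', r)) t| <= `|LJ| * n%:R * `|z - z'|.
  apply: (relaxed_average_dist cU rsigma t0); [exact: cost_extU_continuous..|].
  by move=> u; exact: cost_lipschitz.
by apply: le_trans h; rewrite ler_piMl.
Qed.

Lemma cost_rate_measurable z : measurable_fun (halfline R) (cost_rate z).
Proof.
apply: measurable_funM; first exact: measurable_expRM.
by apply: relaxed_average_measurable => //; exact: cost_extU_continuous.
Qed.

Lemma cost_growth A f (t : R) (u : set_type U) : X f -> 0 <= t ->
  (forall u, `|J (x, u)| <= A) -> `|J (y f t, u)| <= A + `|LJ| * n%:R * C * t.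
Proof.
move=> Xf t0 JA.
have h : `|J (y f t, u) - J (x, u)| <= `|LJ| * n%:R * (C * t).
  apply: (le_trans (cost_lipschitz _ _ _)).
  by rewrite ler_wpM2l ?mulr_ge0// distrC; exact: relaxed_traj_dist_start.
rewrite -[J (y f t, u)](subrK (J (x, u))) addrC.
by apply: (le_trans (ler_normD _ _)); rewrite lerD// -mulrA.
Qed.

(* [A + B t <= (A + 2 B / lambda) exp(lambda t / 2)] absorbs the linear growth. *)
Lemma cost_rate_dominated A f (t : R) : 0 <= A -> X f -> 0 <= t ->
  (forall u, `|J (x, u)| <= A) ->
  `|cost_rate (y f t) t| <=
  (A + 2 * (`|LJ| * n%:R * C) / lambda) * expR (- (lambda / 2) * t).
Proof.
move=> A0 Xf t0 JA; set B := `|LJ| * n%:R * C.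
have B0 : 0 <= B by rewrite !mulr_ge0// ltW.
have h : `|relaxed_average sigma (fun r : set_type U => J (y f t, r)) t| <= A + B * t.
  apply: (relaxed_average_bound cU rsigma t0); first exact: cost_extU_continuous.
  by move=> u; exact: cost_growth.
have g : A + B * t <= (A + 2 * B / lambda) * expR (lambda / 2 * t).
  have e1 := expR_ge1Dx (lambda / 2 * t).
  have lt0 : 0 <= lambda / 2 * t by rewrite mulr_ge0// divr_ge0// ltW.
  have Bl0 : 0 <= 2 * B / lambda by rewrite divr_ge0 ?mulr_ge0// ltW.
  have -> : B * t = 2 * B / lambda * (lambda / 2 * t) by field; rewrite gt_eqF.
  nra.
rewrite /cost_rate normrM ger0_norm ?expR_ge0//.
have -> : - lambda * t = - (lambda / 2) * t - lambda / 2 * t by field.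
rewrite expRD -[leLHS]mulrA [leRHS]mulrC; apply: ler_wpM2l; first exact: expR_ge0.
by rewrite expRN mulrC ler_pdivrMr ?expR_gt0//; exact: le_trans g.
Qed.

Section mean.
Variable P : probability (borel (FT_pointed n U)) R.
Hypothesis PX : P X = 1%E.

Definition mean_cost_rate (t : R) : R := \int[P]_(f in X) cost_rate (y f t) t.

Lemma functions_closed : @closed (FT_pointed n U) X.
Proof. by apply: FT_compact_closed; case: hX => _ []. Qed.

Lemma functions_measurable : measurable (X : set (borel (FT_pointed n U))).
Proof. exact: (@closed_borel (FT_pointed n U) X functions_closed). Qed.

Lemma functions_lty : (P X < +oo)%E.
Proof. by rewrite PX ltey. Qed.

Lemma within_functions_continuous (g : 'rV[R]_n -> R) (M t : R) : 0 <= t ->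
  (forall z z', `|g z - g z'| <= M * `|z - z'|) ->
  {within (X : set (FT_pointed n U)), continuous (fun f => g (y f t))}.
Proof.
move=> t0 gM; apply/subspace_continuousP => f0 Xf0.
apply/cvgrPdist_le => e e0; rewrite near_withinE.
have M1 : 0 < `|M| + 1 by rewrite ltr_wpDl.
have := relaxed_traj_continuous Xf0 t0 (divr_gt0 e0 M1).
apply: filterS => f /= fP Xf; have := fP Xf t t0 (lexx t).
rewrite ler_pdivlMr// => h; apply: (le_trans (gM _ _)); rewrite distrC.
have := ler_norm M; have := normr_ge0 (y f t - y f0 t); nra.
Qed.

Lemma mean_integrable (g : 'rV[R]_n -> R) (M B t : R) : 0 <= t ->
  (forall z z', `|g z - g z'| <= M * `|z - z'|) ->
  (forall f, X f -> `|g (y f t)| <= B) ->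
  P.-integrable X (EFin \o (fun f => g (y f t))).
Proof.
move=> t0 gM gB; apply: (bounded_integrable (M := B)) => //.
- exact: functions_measurable.
- exact: functions_lty.
- apply: (@within_continuous_borel_measurable (FT_pointed n U)).
    exact: functions_closed.
  exact: within_functions_continuous gM.
Qed.

Lemma mean_bound (g : FT n U -> R) (B : R) :
  measurable_fun (X : set (borel (FT_pointed n U))) g ->
  (forall f, X f -> `|g f| <= B) -> `|\int[P]_(f in X) g f| <= B.
Proof.
move=> mg gB.
have E : B * fine (P X) = B by rewrite (congr1 fine PX) mulr1.
rewrite -[leRHS]E; apply: normr_Rintegral_le_cst => //.
- exact: functions_measurable.
- exact: functions_lty.
Qed.

Lemma mean_cost_rate_dominated A (t : R) : 0 <= A -> 0 <= t -> (forall u, `|J (x, u)| <= A) ->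
  `|mean_cost_rate t| <= (A + 2 * (`|LJ| * n%:R * C) / lambda) * expR (- (lambda / 2) * t).
Proof.
move=> A0 t0 JA; apply: mean_bound; last first.
  by move=> f Xf; exact: cost_rate_dominated.
apply: (@within_continuous_borel_measurable (FT_pointed n U)).
  exact: functions_closed.
by apply: (@within_functions_continuous (cost_rate^~ t) _ t t0) => z z'; exact: cost_rate_lipschitz.
Qed.

(** X is partitioned by closeness of trajectories on [0, T]; on each piece the node trajectory
    replaces all others, and the average becomes a finite sum of measurable functions of time. *)
Lemma mean_rate_measurable (Phi : 'rV[R]_n -> R -> R) (M : R) (B : R -> R) :
  (forall z, measurable_fun (halfline R) (Phi z)) ->
  (forall z z' (t : R), 0 <= t -> `|Phi z t - Phi z' t| <= M * `|z - z'|) ->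
  (forall f (t : R), X f -> 0 <= t -> `|Phi (y f t) t| <= B t) ->
  measurable_fun (halfline R) (fun t => \int[P]_(f in X) Phi (y f t) t).
Proof.
move=> mPhi lPhi PhiB.
have cX : @compact (FT_pointed n U) X by case: hX => _ [].
have X0 : X !=set0 by case: hX.
apply: measurable_fun_locally_uniform_approx => e T0 e0; pose T := Num.max T0 0.
have T0T : T0 <= T by rewrite le_max lexx.
have Tge0 : 0 <= T by rewrite le_max lexx orbT.
have M1 : 0 < `|M| + 1 by rewrite ltr_wpDl.
have [|N [c [A [cA Ae]]]] := @exists_compact_partition (FT_pointed n U) X
    (fun f0 f => forall t : R, 0 <= t -> t <= T ->
      `|y f t - y f0 t| <= e / (`|M| + 1)) cX functions_closed X0.
  by move=> f0 Xf0; exact: (relaxed_traj_continuous Xf0 Tge0 (divr_gt0 e0 M1)).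
have Xc j : X (c j) by case: cA.
exists (fun t => \sum_(j < N) Phi (y (c j) t) t * fine (P (A j))); split.
  apply: (@measurable_sum _ _ R _ 'I_N _
    (fun j t => Phi (y (c j) t) t * fine (P (A j)))) => j.
  apply: measurable_funM; last exact: measurable_cst.
  apply: (measurable_caratheodory_comp mPhi lPhi).
  by have [] := relaxed_traj_solution (Xc j).
move=> t t0 tT.
apply: (@Rintegral_partition_dist _ _ P _ _ _ _ cA functions_measurable
  (fun f => Phi (y f t) t) (B t) e PX).
- apply: (@within_continuous_borel_measurable (FT_pointed n U)).
    exact: functions_closed.
  by apply: (@within_functions_continuous (Phi^~ t) M t t0) => z z'; exact: lPhi.
- by move=> f Xf; exact: PhiB.
- move=> j f Af; apply: (le_trans (lPhi _ _ _ t0)).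
  have := Ae _ _ Af t t0 (le_trans tT T0T); rewrite ler_pdivlMr// => h.
  by have := normr_ge0 (y f t - y (c j) t); have := ler_norm M; nra.
Qed.

Lemma mean_cost_rate_measurable : measurable_fun (halfline R) mean_cost_rate.
Proof.
have [A A0 JA] := cost_bound.
apply: (@mean_rate_measurable cost_rate (`|LJ| * n%:R) (fun t =>
  (A + 2 * (`|LJ| * n%:R * C) / lambda) * expR (- (lambda / 2) * t)) cost_rate_measurable).
  by move=> z z' t t0; exact: cost_rate_lipschitz.
by move=> f t Xf t0; exact: cost_rate_dominated.
Qed.

Lemma mean_cost_rate_integrable :
  mu.-integrable (halfline R) (EFin \o mean_cost_rate).
Proof.
have [A A0 JA] := cost_bound.
set D := A + 2 * (`|LJ| * n%:R * C) / lambda.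
have D0 : 0 <= D by rewrite addr_ge0// divr_ge0 ?mulr_ge0// ltW.
have l2 : 0 < lambda / 2 by rewrite divr_gt0.
apply: (le_integrable _ _ _ (Rintegral_expRNM 0 D0 l2).1) => //.
  by apply/measurable_EFinP; exact: mean_cost_rate_measurable.
move=> t; rewrite /= in_itv/= andbT => t0; rewrite lee_fin.
apply: (le_trans (mean_cost_rate_dominated A0 t0 JA)); exact: ler_norm.
Qed.

End mean.
End control.
End RelaxedTrajectories.

(** * The value function *)

Section RelaxedCost.
Context (R : realType) (n m : nat) (U : set 'rV[R]_m) (X : set (FT n U)).
Context (L C LJ lambda : R) (J : dom n U -> R) (x : 'rV[R]_n).
Hypothesis cU : compact U.
Hypothesis hX : H1 X L C.
Hypothesis hJ : H2 J LJ.
Hypothesis lambda0 : 0 < lambda.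
Notation mu := (@lebesgue_measure R).

Section weak_continuity.
Context (sigma : R -> probability (borel 'rV[R]_m) R) (y : FT n U -> R -> 'rV[R]_n).
Hypothesis rsigma : relaxed_control U sigma.
Hypothesis ry : relaxed_traj X sigma x y.
Context (pi : R -> probability (borel (FT n U)) R).
Hypothesis piX : forall s, 0 <= s -> as_pointed (pi s) X = 1%E.
Hypothesis pi_lsc : forall c : FT n U -> R, {within X, continuous c} ->
  forall s, 0 <= s -> lsc_at (fun r => \int[pi r]_(f in X) c f) s.

(* Applying lower semicontinuity to both [c] and [- c] yields continuity. *)
Lemma mean_cost_rate_cvg (r : nat -> R) (s t : R) :
  (forall k, 0 <= r k) -> 0 <= s -> 0 <= t -> r @ \oo --> s ->
  (fun k => mean_cost_rate X lambda J sigma y (as_pointed (pi (r k))) t) @ \oo -->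
  mean_cost_rate X lambda J sigma y (as_pointed (pi s)) t.
Proof.
move=> r0 s0 t0 rs; have [A A0 JA] := cost_bound x cU hJ.
pose c (f : FT n U) := cost_rate lambda J sigma (y f t) t.
have cc : {within X, continuous c}.
  apply: (within_functions_continuous cU hX rsigma ry (g := (cost_rate lambda J sigma)^~ t)
    (M := `|LJ| * n%:R) t0) => z z'.
  exact: cost_rate_lipschitz cU hJ lambda0 _ rsigma z z' t t0.
have cNc : {within X, continuous (fun f => - c f)}.
  apply: (within_functions_continuous cU hX rsigma ry
    (g := fun z => - cost_rate lambda J sigma z t) (M := `|LJ| * n%:R) t0) => z z'.
  rewrite -opprD normrN.
  exact: cost_rate_lipschitz cU hJ lambda0 _ rsigma z z' t t0.
pose I p := \int[as_pointed (pi p)]_(f in X) c f.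
have intN p : 0 <= p -> \int[as_pointed (pi p)]_(f in X) (- c f) = - I p.
  move=> p0; apply: RintegralN; first exact: (functions_measurable hX).
  exact: (mean_integrable cU hX rsigma ry (P := as_pointed (pi p)) (piX p0)
    (g := (cost_rate lambda J sigma)^~ t) t0
    (fun z z' => cost_rate_lipschitz cU hJ lambda0 rsigma z z' t0)
    (fun f Xf => cost_rate_dominated cU hX hJ lambda0 rsigma ry A0 Xf t0 JA)).
suff : (fun k => I (r k)) @ \oo --> I s by [].
apply/cvgrPdist_lt => e e0.
have [d1 [d1_gt0 h1]] := pi_lsc cc s0 e0.
have [d2 [d2_gt0 h2]] := pi_lsc cNc s0 e0.
have {}h1 p : 0 <= p -> `|p - s| < d1 -> I s - e < I p by exact: h1.
have {}h2 p : 0 <= p -> `|p - s| < d2 ->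
    \int[as_pointed (pi s)]_(f in X) (- c f) - e < \int[as_pointed (pi p)]_(f in X) (- c f).
  exact: h2.
have {}h2 p : 0 <= p -> `|p - s| < d2 -> - I s - e < - I p.
  by move=> p0 ps; have := h2 p p0 ps; rewrite !intN.
have d0 : 0 < Num.min d1 d2 by rewrite lt_min d1_gt0.
move/cvgrPdist_lt/(_ _ d0) : rs; apply: filterS => k.
rewrite distrC lt_min => /andP[k1 k2].
by have := h1 _ (r0 k) k1; have := h2 _ (r0 k) k2; rewrite ltr_norml; lra.
Qed.

Lemma relaxed_costE s : relaxed_cost X pi J lambda sigma y s =
  \int[mu]_(t in halfline R) mean_cost_rate X lambda J sigma y (as_pointed (pi s)) t.
Proof.
apply: eq_Rintegral => t _.
exact: (esym (Rintegral_as_pointed (pi s) X (fun f => cost_rate lambda J sigma (y f t) t))).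
Qed.

Lemma relaxed_cost_lsc s : 0 <= s -> lsc_at (relaxed_cost X pi J lambda sigma y) s.
Proof.
move=> s0 e e0; apply: contrapT => H.
(* Dominated convergence speaks of sequences, so a failure of lower semicontinuity is first turned
   into times [r k] tending to [s] whose cost stays lower by [e]. *)
have /choice [r rP] : forall k : nat, exists r : R, [/\ 0 <= r, `|r - s| < k.+1%:R^-1 &
    relaxed_cost X pi J lambda sigma y r <= relaxed_cost X pi J lambda sigma y s - e].
  move=> k; apply: contrapT => Hk; apply: H; exists k.+1%:R^-1.
  split=> [|r r0 rs]; first by rewrite invr_gt0.
  by rewrite ltNge; apply/negP => re; apply: Hk; exists r.
have rs : r @ \oo --> s.
  apply/cvgrPdist_lt => d d0; near=> k; rewrite distrC.
  have [_ rk _] := rP k; apply: (lt_trans rk).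
  by near: k; exact: near_infty_natSinv_lt (PosNum d0).
have r0 k : 0 <= r k by case: (rP k).
have [A A0 JA] := cost_bound x cU hJ.
pose D := A + 2 * (`|LJ| * n%:R * C) / lambda.
have C0 : 0 < C by case: hX => _ [_ [_ []]].
have D0 : 0 <= D by rewrite addr_ge0// divr_ge0 ?mulr_ge0// ltW.
have l2 : 0 < lambda / 2 by rewrite divr_gt0.
pose g p := EFin \o mean_cost_rate X lambda J sigma y (as_pointed (pi p)).
have mg p : 0 <= p -> measurable_fun (halfline R) (g p).
  move=> p0; apply/measurable_EFinP.
  exact: (mean_cost_rate_measurable cU hX hJ lambda0 rsigma ry (piX p0)).
have [||||||_ _ cvg] := @dominated_convergence _ _ R mu (halfline R) _
  (fun k => g (r k)) (g s) (EFin \o (fun t => D * expR (- (lambda / 2) * t))).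
- exact: measurable_itv.
- by move=> k; exact: mg.
- exact: mg.
- apply: aeW => t; rewrite /= in_itv/= andbT => t0.
  by apply: cvg_EFin; [exact: nearW|exact: mean_cost_rate_cvg].
- exact: (Rintegral_expRNM 0 D0 l2).1.
- apply: aeW => t k; rewrite /= in_itv/= andbT => t0; rewrite lee_fin.
  exact: (mean_cost_rate_dominated cU hX hJ lambda0 rsigma ry (piX (r0 k)) A0 t0 JA).
have fE p : relaxed_cost X pi J lambda sigma y p =
    fine (\int[mu]_(t in halfline R) g p t)%E by rewrite relaxed_costE.
have gE : (\int[mu]_(t in halfline R) g s t)%E = (relaxed_cost X pi J lambda sigma y s)%:E.
  rewrite fE fineK//; apply: integrable_fin_num => //.
  exact: (mean_cost_rate_integrable cU hX hJ lambda0 rsigma ry (piX s0)).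
have {}cvg : relaxed_cost X pi J lambda sigma y (r k) @[k --> \oo] -->
    relaxed_cost X pi J lambda sigma y s.
  rewrite gE in cvg; under eq_fun do rewrite fE.
  exact: (fine_cvg cvg).
have e2 : 0 < e / 2 by rewrite divr_gt0.
move/cvgrPdist_lt/(_ _ e2) : cvg => -[N _ /(_ N (leqnn N))] /=.
have [_ _] := rP N; rewrite ltr_norml.
move: (relaxed_cost X pi J lambda sigma y (r N)) (relaxed_cost X pi J lambda sigma y s).
by move=> p q; lra.
Unshelve. all: by end_near. Qed.

(** The bound is the same for every control. It makes the set of ordinary costs bounded below, so
    that the infimum in [value] is a lower bound of it. *)
Lemma relaxed_cost_bound A s : 0 <= A -> (forall u, `|J (x, u)| <= A) -> 0 <= s ->
  `|relaxed_cost X pi J lambda sigma y s| <=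
  (A + 2 * (`|LJ| * n%:R * C) / lambda) / (lambda / 2).
Proof.
move=> A0 JA s0; set D := A + 2 * (`|LJ| * n%:R * C) / lambda.
have C0 : 0 < C by case: hX => _ [_ [_ []]].
have D0 : 0 <= D by rewrite addr_ge0// divr_ge0 ?mulr_ge0// ltW.
have l2 : 0 < lambda / 2 by rewrite divr_gt0.
have [intD DE] := Rintegral_expRNM 0 D0 l2; rewrite mulr0 expR0 mulr1 in DE.
rewrite relaxed_costE -DE; apply: normr_Rintegral_le => //.
  exact: (mean_cost_rate_measurable cU hX hJ lambda0 rsigma ry (piX s0)).
move=> t; rewrite /= in_itv/= andbT => t0.
exact: (mean_cost_rate_dominated cU hX hJ lambda0 rsigma ry (piX s0) A0 t0 JA).
Qed.

End weak_continuity.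

Section ordinary.
Context (u : R -> set_type U) (y : FT n U -> R -> 'rV[R]_n).

Lemma relaxed_field_dirac f i z (t : R) : X f -> 0 <= t ->
  relaxed_field (dirac_control u) f i z t = f (z, u t) ord0 i.
Proof.
move=> Xf t0; rewrite /relaxed_field (relaxed_average_dirac cU)//.
exact: field_extU_continuous hX _ _ _ Xf.
Qed.

Lemma cost_rate_dirac z (t : R) : 0 <= t ->
  cost_rate lambda J (dirac_control u) z t = expR (- lambda * t) * J (z, u t).
Proof.
move=> t0; rewrite /cost_rate (relaxed_average_dirac cU)//.
exact: cost_extU_continuous hJ _.
Qed.

Lemma ordinary_trajP : ordinary_traj X u x y <-> relaxed_traj X (dirac_control u) x y.
Proof.
have E f i t : X f -> \int[mu]_(s in `[0, t]) relaxed_field (dirac_control u) f i (y f s) s =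
    \int[mu]_(s in `[0, t]) (f (y f s, u s)) ord0 i.
  move=> Xf; apply: eq_Rintegral => s /set_mem/=; rewrite in_itv/= => /andP[s0 _].
  exact: relaxed_field_dirac.
split=> H f Xf; have [cy yE] := H f Xf; split=> // t t0 i.
  by rewrite yE// -E.
by rewrite yE// -E.
Qed.

Lemma ordinary_costE (pi : R -> probability (borel (FT n U)) R) s :
  ordinary_cost X pi J lambda u y s =
  relaxed_cost X pi J lambda (dirac_control u) y s.
Proof.
apply: eq_Rintegral => t /set_mem/=; rewrite in_itv/= andbT => t0.
apply: eq_Rintegral => f _.
by rewrite -[RHS]/(cost_rate lambda J (dirac_control u) (y f t) t) cost_rate_dirac.
Qed.

End ordinary.

Lemma value_le_ordinary_cost (pi : R -> probability (borel (FT n U)) R) s u y :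
  as_pointed (pi s) X = 1%E -> ordinary_control u -> ordinary_traj X u x y -> 
  value X pi J lambda s x <= ordinary_cost X pi J lambda u y s.
Proof.
move=> piX ou oy; have [A A0 JA] := cost_bound x cU hJ.
apply: ge_inf; last by exists u, y.
exists (- ((A + 2 * (`|LJ| * n%:R * C) / lambda) / (lambda / 2))).
move=> _ [u' [y' [ou' oy' ->]]]; rewrite ordinary_costE//.
(* Freezing the probability at [pi s] and evaluating at time 0 meets the mass condition at all
   nonnegative times from the single assumption on [pi s]. *)
pose pi' (_ : R) := pi s.
have -> : relaxed_cost X pi J lambda (dirac_control u') y' s =
  relaxed_cost X pi' J lambda (dirac_control u') y' 0 by [].
have := @relaxed_cost_bound (dirac_control u') y' (dirac_relaxed_control ou')
  ((ordinary_trajP u' y').1 oy') pi' (fun _ _ => piX) A 0 A0 JA (lexx 0).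
by rewrite ler_norml => /andP[].
Qed.

End RelaxedCost.

(** * The relaxation theorem: ordinary controls approximate relaxed ones *)

Section Relaxation.
Context (R : realType) (n m : nat) (U : set 'rV[R]_m) (X : set (FT n U)).
Context (L C LJ lambda : R) (J : dom n U -> R) (x : 'rV[R]_n).
Hypothesis cU : compact U.
Hypothesis hX : H1 X L C.
Hypothesis hJ : H2 J LJ.
Hypothesis lambda0 : 0 < lambda.
Notation mu := (@lebesgue_measure R).
Notation K := (n%:R * L + 1).
Context (sigma : R -> probability (borel 'rV[R]_m) R) (y : FT n U -> R -> 'rV[R]_n).
Hypothesis rsigma : relaxed_control U sigma.
Hypothesis ry : relaxed_traj X sigma x y.

Let L0 : 0 < L. Proof. by case: hX => _ [_ []]. Qed.
Let C0 : 0 < C. Proof. by case: hX => _ [_ [_ []]]. Qed.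
Let K1 : 1 <= K. Proof. by rewrite lerDr mulr_ge0// ltW. Qed.
Let K0 : 0 < K. Proof. exact: lt_le_trans K1. Qed.

(** (H2) gives no modulus of continuity in the control. Compactness of the ball of states makes
    continuity at the points (z, u0) uniform in z, as in the tube lemma. *)
Lemma cost_equicontinuous (u0 : set_type U) (rho e : R) : 0 < e ->
  nbhs u0 [set u | forall z : 'rV[R]_n, `|x - z| <= rho -> `|J (z, u) - J (z, u0)| <= e].
Proof.
move=> e0; case: hJ => cJ _.
have e2 : 0 < e / 2 by rewrite divr_gt0.
have /compact_near_coveringP cB := @closed_ball_compact R n x rho.
apply: (cB _ (nbhs u0) (fun u z => `|J (z, u) - J (z, u0)| <= e)) => z zB.
have /cvgrPdist_lt/(_ _ e2) [[A B] /= [zA uB] AB] := cJ (z, u0).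
exists (A, B) => //= -[z' u] /= [Az' Bu].
have h1 := AB (z', u) (conj Az' Bu).
have h2 := AB (z', u0) (conj Az' (nbhs_singleton uB)).
by move: h1 h2; rewrite ler_norml !ltr_norml /=; lra.
Qed.

(** One partition must suit all f in X. For the fields the Lipschitz bound in the control holds for
    every f and every state; for the cost only states within [rho] of [x] are controlled, whence the
    two different conditions. *)
Lemma exists_control_partition (rho e a : R) : 0 < e -> 0 < a ->
  exists N c A, [/\ compact_partition U N c A,
    forall j r z, A j r -> `|x - z| <= rho ->
      `|extU (fun u => J (z, u)) r - extU (fun u => J (z, u)) (c j)| <= e &
    forall j r f i z, X f -> A j r ->
      `|extU (fun u => f (z, u) ord0 i) r - extU (fun u => f (z, u) ord0 i) (c j)| <= a].
Proof.
move=> e0 a0.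
have [|N [c [A [cA Ae]]]] := @exists_compact_partition _ U
  (fun b b' => (forall z, `|x - z| <= rho ->
      `|extU (fun u => J (z, u)) b' - extU (fun u => J (z, u)) b| <= e) /\
    `|b' - b| <= a / (L * m%:R + 1)) cU (closed_domain cU) (domain_nonempty rsigma).
  move=> b Ub; have [u0 ->] := extU_ex Ub.
  have [V [[W oW WV] Vu0 VP]] := cost_equicontinuous u0 rho e0.
  have Lm : 0 < L * m%:R + 1 by rewrite ltr_wpDl// mulr_ge0// ltW.
  have n1 : nbhs (val u0) W.
    by apply: open_nbhs_nbhs; split => //; move: Vu0; rewrite -WV.
  have n2 : nbhs (val u0) [set b' | `|b' - val u0| <= a / (L * m%:R + 1)].
    apply/nbhs_ballP; exists (a / (L * m%:R + 1)); first exact: divr_gt0.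
    by move=> b'; rewrite -ball_normE/= distrC => /ltW.
  apply: filterS (filterI n1 n2) => b' [Wb' b'a] Ub'; split => // z zx.
  have [u uE] := extU_ex Ub'; rewrite uE !extU_val.
  by apply: VP => //; rewrite -WV /= -[set_val u]/(val u) -uE.
exists N, c, A; split => // [j r z Ajr|j r f i z Xf Ajr]; first exact: (Ae _ _ Ajr).1.
have [_ AU _ _ Uc] := cA.
have [_ +] := Ae _ _ Ajr.
have [u uE] := extU_ex (AU _ _ Ajr); have [v vE] := extU_ex (Uc j).
rewrite uE vE !extU_val ler_pdivlMr; last by rewrite ltr_wpDl// mulr_ge0// ltW.
move=> h; apply: (le_trans (field_entry_lipschitz hX i z z u v Xf)).
rewrite subrr normr0 mulr0 add0r.
by have := normr_ge0 (val u - val v); nra.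
Qed.

Section selection.
Context (N : nat) (c : nat -> 'rV[R]_m) (A : nat -> set (borel 'rV[R]_m)) (h : R).
Hypothesis cA : compact_partition U N c A.
Hypothesis h0 : 0 < h.

Definition control_weight j t : R := fine (sigma t (A j)).

Definition control_node j : set_type U :=
  let: And5 _ _ _ _ Uc := cA in SigSub (mem_set (Uc j)).

Lemma val_control_node j : val (control_node j) = c j.
Proof. by rewrite /control_node; case: cA. Qed.

Lemma control_weight_measurable j : measurable_fun (halfline R) (control_weight j).
Proof.
apply: (@measurableT_comp _ _ _ _ _ _ fine) => //.
by case: rsigma => _; apply; case: cA.
Qed.

Lemma control_weight_ge0 j (t : R) : 0 <= t -> 0 <= control_weight j t.
Proof. by move=> _; exact: fine_ge0. Qed.

Lemma control_weight_sum (t : R) : 0 <= t -> \sum_(j < N) control_weight j t = 1.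
Proof.
move=> t0; apply: (partition_prob_sum cA (domain_measurable cU)).
by case: rsigma => sU _; exact: sU.
Qed.

Context (idx : R -> nat).
Hypothesis idxN : forall s : R, 0 <= s -> (idx s < N)%N.
Hypothesis midx : forall j, measurable (halfline R `&` [set s | idx s = j]).
Hypothesis idx_cell : forall j k, (j < N)%N ->
  \int[mu]_(s in (`[k%:R * h, k.+1%:R * h[%classic : set R)) (idx s == j)%:R =
  \int[mu]_(s in (`[k%:R * h, k.+1%:R * h[%classic : set R)) control_weight j s.

Definition chattering_control (t : R) : set_type U := control_node (idx t).

Lemma chattering_control_ordinary : ordinary_control chattering_control.
Proof.
move=> B oB.
rewrite (_ : _ `&` _ = \bigcup_(j in [set j | B (c j)])
    (halfline R `&` [set s | idx s = j])).
  by apply: bigcup_measurable => j _; exact: midx.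
apply/seteqP; split => s /=.
  by move=> [sH]; rewrite /chattering_control val_control_node => Bs; exists (idx s).
by move=> [j /= Bj [sH sj]]; split => //; rewrite /chattering_control val_control_node sj.
Qed.

Lemma chattering_sum_select (q : nat -> R) (t : R) : 0 <= t ->
  \sum_(j < N) (idx t == j)%:R * q j = q (idx t).
Proof.
move=> t0; rewrite (bigD1 (Ordinal (idxN t0)))//= eqxx mul1r big1 ?addr0// => j /eqP ij.
by case: eqP => [e|_]; [exfalso; apply: ij; exact: val_inj|rewrite mul0r].
Qed.

(* The velocities along [y f] under the two controls have close primitives because
   on every cell they differ by the oscillation of [s |-> f (y f s, c j)] only. *)
Lemma chattering_traj_defect (a : R) f i (t : R) : X f -> 0 <= a ->
  (forall j r z, A j r ->
    `|extU (fun u => f (z, u) ord0 i) r - extU (fun u => f (z, u) ord0 i) (c j)| <= a) ->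
  0 <= t ->
  `|x ord0 i + \int[mu]_(s in `[0, t])
      relaxed_field (dirac_control chattering_control) f i (y f s) s - y f t ord0 i|
  <= a * t + (2 * (L * n%:R * C * h) * t + 2 * C * h).
Proof.
move=> Xf a0 Aa t0.
have sol := relaxed_traj_solution ry Xf; have [cy yE] := sol.
have cF := relaxed_field_caratheodory cU hX rsigma Xf.
have cF' := relaxed_field_caratheodory cU hX
  (dirac_relaxed_control chattering_control_ordinary) Xf.
rewrite yE// opprD addrACA subrr add0r -RintegralB//; last 2 first.
- exact: integrable_field cF' _ _ _ cy.
- exact: integrable_field cF _ _ _ cy.
pose q j s := f (y f s, control_node j) ord0 i.
have qL j s r : 0 <= s -> 0 <= r -> `|q j s - q j r| <= L * n%:R * C * `|s - r|.
  move=> s0 r0; apply: (le_trans (field_entry_lipschitz hX _ _ _ _ _ Xf)).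
  rewrite subrr normr0 mulr0 addr0 -!mulrA ler_wpM2l// ?(ltW L0)// ler_wpM2l//.
  exact: (relaxed_traj_lipschitz cU hX rsigma ry Xf s0 r0).
have mq j : measurable_fun (halfline R) (q j).
  apply: (measurable_caratheodory_comp (V := 'rV[R]_n) (L := L * n%:R)
    (Phi := fun z _ => f (z, control_node j) ord0 i)) => //.
  move=> z z' s _; have := field_entry_lipschitz hX i z z' (control_node j) (control_node j) Xf.
  by rewrite subrr normr0 mulr0 addr0 mulrA.
have qB j s : `|q j s| <= C by exact: (field_entry_bound hX).
pose F s := relaxed_field sigma f i (y f s) s.
have mF : measurable_fun (halfline R) F by exact: (measurable_field cF).
(* The weighted node velocities are inserted between the two fields: [S1] is the chattering error,
   small only after integration, and [S2] is the partition error, at most [a] at each time. *)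
pose S1 s : R := \sum_(j < N) ((idx s == j)%:R - control_weight j s) * q j s.
pose S2 s : R := \sum_(j < N) control_weight j s * q j s - F s.
have FE s : 0 <= s ->
  relaxed_field (dirac_control chattering_control) f i (y f s) s - F s = S1 s + S2 s.
  move=> s0; rewrite (relaxed_field_dirac cU hX)// /S2 addrA; congr (_ - _).
  rewrite /S1 -big_split/= -[LHS](chattering_sum_select (q^~ s))//.
  by apply: eq_bigr => j _; ring.
have sub : (`[0, t]%classic : set R) `<=` halfline R.
  by move=> s /=; rewrite !in_itv/= andbT => /andP[].
have mw := control_weight_measurable.
have mS1 : measurable_fun (`[0, t]%classic : set R) S1.
  apply: (@measurable_sum _ _ R _ 'I_N _
    (fun j s => ((idx s == j)%:R - control_weight j s) * q j s)) => j.
  apply: measurable_funM; last by apply: measurable_funS (mq j).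
  apply: measurable_funB; last by apply: measurable_funS (mw j).
  by apply: measurable_funS (measurable_chattering_indicator midx j).
have mS2 : measurable_fun (`[0, t]%classic : set R) S2.
  apply: measurable_funB; last by apply: measurable_funS mF.
  apply: (@measurable_sum _ _ R _ 'I_N _ (fun j s => control_weight j s * q j s)) => j.
  by apply: measurable_funM; [apply: measurable_funS (mw j)|apply: measurable_funS (mq j)].
have S1B s : (`[0, t]%classic : set R) s -> `|S1 s| <= 2 * C.
  rewrite /= in_itv/= => /andP[s0 _].
  exact: (chattering_sum_le control_weight_ge0 control_weight_sum idxN (p := q^~ s) s0
    (ltW C0) (fun j _ => qB j s)).
have S2B s : (`[0, t]%classic : set R) s -> `|S2 s| <= a.
  rewrite /= in_itv/= => /andP[s0 _]; rewrite distrC /S2.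
  have := relaxed_average_partition cU rsigma s0 cA
    (@field_extU_continuous _ _ _ _ _ _ _ hX f i (y f s) Xf) (fun j r => Aa j r (y f s)).
  rewrite (eq_bigr (fun j : 'I_N => control_weight j s * q j s))// => j _.
  by rewrite mulrC -val_control_node extU_val.
have -> : \int[mu]_(s in `[0, t])
    (relaxed_field (dirac_control chattering_control) f i (y f s) s -
     relaxed_field sigma f i (y f s) s) = \int[mu]_(s in `[0, t]) (S1 s + S2 s).
  by apply: eq_Rintegral => s /set_mem/=; rewrite in_itv/= => /andP[s0 _]; exact: FE.
rewrite RintegralD//; last 2 first.
- exact: (bounded_itv_integrable mS1 S1B).
- exact: (bounded_itv_integrable mS2 S2B).
rewrite addrC; apply: (le_trans (ler_normD _ _)); apply: lerD.
  by have := normr_itv_Rintegral_le t0 mS2 S2B; rewrite subr0.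
apply: (chattering_estimate control_weight_measurable control_weight_ge0
  control_weight_sum h0 idxN midx idx_cell) => //.
- by rewrite !mulr_ge0// ltW.
- exact: ltW.
- move=> j s r _ s0 _ r0 _ sr; apply: (le_trans (qL j s r s0 r0)).
  by rewrite ler_wpM2l// !mulr_ge0// ltW.
Qed.

Lemma discount_lipschitz (s r : R) : 0 <= s -> 0 <= r ->
  `|expR (- lambda * s) - expR (- lambda * r)| <= lambda * `|s - r|.
Proof.
wlog sr : s r / s <= r.
  move=> H s0 r0; have [sr|/ltW rs] := leP s r; first exact: H.
  by rewrite distrC [X in _ <= _ * X]distrC; exact: H.
move=> s0 r0.
have -> : expR (- lambda * r) = expR (- lambda * s) * expR (- (lambda * (r - s))).
  by rewrite -expRD; congr expR; ring.
have /andP[e0 e1] := discount_le1 lambda0 s0.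
have h1 := expR_ge1Dx (- (lambda * (r - s))).
have lrs : 0 <= lambda * (r - s) by rewrite mulr_ge0 ?subr_ge0// ltW.
have h2 : expR (- (lambda * (r - s))) <= 1 by rewrite -expR0 ler_expR oppr_le0.
rewrite ger0_norm; last by rewrite subr_ge0 ler_piMr.
rewrite distrC ger0_norm ?subr_ge0//.
nra.
Qed.

Section cost.
Variable P : probability (borel (FT_pointed n U)) R.
Hypothesis PX : P X = 1%E.
Variable y' : FT n U -> R -> 'rV[R]_n.
Hypothesis ry' : relaxed_traj X (dirac_control chattering_control) x y'.

Definition node_rate j (z : 'rV[R]_n) (s : R) : R :=
  expR (- lambda * s) * J (z, control_node j).

Lemma node_rate_lipschitz j z z' (s : R) : 0 <= s ->
  `|node_rate j z s - node_rate j z' s| <= `|LJ| * n%:R * `|z - z'|.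
Proof.
move=> s0; have /andP[e0 e1] := discount_le1 lambda0 s0.
rewrite -mulrBr normrM (ger0_norm e0).
by apply: le_trans (cost_lipschitz hJ z z' (control_node j)); rewrite ler_piMl.
Qed.

Variables (M0 T : R).
Hypothesis M0_ge0 : 0 <= M0.
Hypothesis T0 : 0 <= T.
Hypothesis JM : forall u : set_type U, `|J (x, u)| <= M0.
Let B := M0 + `|LJ| * n%:R * C * T.

Let rdirac := dirac_relaxed_control chattering_control_ordinary.

Lemma node_rate_bound j f (s : R) : X f -> 0 <= s ->
  `|node_rate j (y f s) s| <= M0 + `|LJ| * n%:R * C * s.
Proof.
move=> Xf s0; have /andP[e0 e1] := discount_le1 lambda0 s0.
rewrite normrM (ger0_norm e0).
apply: (le_trans _ (cost_growth cU hX hJ rsigma ry (control_node j) Xf s0 JM)).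
by rewrite ler_piMl.
Qed.

Let bound_le_B (s : R) : s <= T -> M0 + `|LJ| * n%:R * C * s <= B.
Proof. by move=> sT; rewrite lerD2l ler_wpM2l// !mulr_ge0// ltW. Qed.

Let B_ge0 : 0 <= B.
Proof. by rewrite addr_ge0// !mulr_ge0// ltW. Qed.

(** The state moves at speed at most [C], which gives the first term of the constant; the discount
    factor varies at rate at most [lambda], which gives the second. *)
Lemma node_rate_oscillation j f (s r : R) : X f ->
  0 <= s -> s <= T -> 0 <= r -> r <= T ->
  `|node_rate j (y f s) s - node_rate j (y f r) r| <=
  (`|LJ| * n%:R * C + lambda * B) * `|s - r|.
Proof.
move=> Xf s0 sT r0 rT.
have h1 : `|node_rate j (y f s) s - node_rate j (y f r) s| <= `|LJ| * n%:R * C * `|s - r|.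
  apply: (le_trans (node_rate_lipschitz _ _ _ s0)).
  by rewrite -!mulrA ler_wpM2l// ler_wpM2l//; exact: (relaxed_traj_lipschitz cU hX rsigma ry).
have h2 : `|node_rate j (y f r) s - node_rate j (y f r) r| <= lambda * B * `|s - r|.
  rewrite -mulrBl normrM mulrAC; apply: ler_pM => //; first exact: discount_lipschitz.
  exact: le_trans (cost_growth cU hX hJ rsigma ry _ Xf r0 JM) (bound_le_B rT).
have -> : node_rate j (y f s) s - node_rate j (y f r) r =
  (node_rate j (y f s) s - node_rate j (y f r) s) +
  (node_rate j (y f r) s - node_rate j (y f r) r) by rewrite addrA subrK.
by rewrite mulrDl (le_trans (ler_normD _ _))// lerD.
Qed.

(** Averaged over X, the cost at a fixed node is a scalar function of time, to which the chattering
    estimate applies directly. *)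
Definition mean_node_rate j (s : R) : R := \int[P]_(f in X) node_rate j (y f s) s.

Lemma node_rate_mean_integrable j (s : R) : 0 <= s ->
  P.-integrable X (EFin \o (fun f => node_rate j (y f s) s)).
Proof.
move=> s0; apply: (mean_integrable cU hX rsigma ry PX (g := (node_rate j)^~ s)
  (M := `|LJ| * n%:R) (B := M0 + `|LJ| * n%:R * C * s) s0).
  by move=> z z'; exact: node_rate_lipschitz.
by move=> f Xf; exact: node_rate_bound.
Qed.

Lemma mean_node_rate_measurable j : measurable_fun (halfline R) (mean_node_rate j).
Proof.
apply: (mean_rate_measurable cU hX rsigma ry PX (Phi := node_rate j)
  (M := `|LJ| * n%:R) (B := fun s => M0 + `|LJ| * n%:R * C * s)).
- by move=> z; apply: measurable_funM; [exact: measurable_expRM|exact: measurable_cst].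
- by move=> z z' s s0; exact: node_rate_lipschitz.
- by move=> f s Xf s0; exact: node_rate_bound.
Qed.

Lemma mean_dist (g g' : FT n U -> R) (e : R) :
  P.-integrable X (EFin \o (g : borel (FT_pointed n U) -> R)) ->
  P.-integrable X (EFin \o (g' : borel (FT_pointed n U) -> R)) ->
  (forall f, X f -> `|g f - g' f| <= e) ->
  `|\int[P]_(f in X) g f - \int[P]_(f in X) g' f| <= e.
Proof.
move=> ig ig' gg'; rewrite -RintegralB//; last exact: (functions_measurable hX).
apply: (mean_bound hX PX) => //; apply: measurable_funB; apply/measurable_EFinP.
  by case/integrableP: ig.
by case/integrableP: ig'.
Qed.

Lemma mean_node_rate_bound j (s : R) : 0 <= s -> s <= T -> `|mean_node_rate j s| <= B.
Proof.
move=> s0 sT; apply: (mean_bound hX PX).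
  by apply/measurable_EFinP; case/integrableP: (node_rate_mean_integrable j s0).
by move=> f Xf; exact: le_trans (node_rate_bound _ Xf s0) (bound_le_B sT).
Qed.

Lemma chattering_cost_defect (d w : R) : 0 <= w ->
  (forall f (t : R), X f -> 0 <= t -> t <= T -> `|y' f t - y f t| <= d) ->
  (forall j r z, A j r -> `|x - z| <= C * T ->
    `|extU (fun u => J (z, u)) r - extU (fun u => J (z, u)) (c j)| <= w) ->
  `|\int[mu]_(t in `[0, T])
      mean_cost_rate X lambda J (dirac_control chattering_control) y' P t -
    \int[mu]_(t in `[0, T]) mean_cost_rate X lambda J sigma y P t|
  <= (`|LJ| * n%:R * d + w) * T +
     (2 * ((`|LJ| * n%:R * C + lambda * B) * h) * T + 2 * B * h).
Proof.
move=> w0 yd Aw.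
pose Gu t : R := mean_cost_rate X lambda J (dirac_control chattering_control) y' P t.
pose Gs t : R := mean_cost_rate X lambda J sigma y P t.
have mGu : measurable_fun (halfline R) Gu.
  exact: (mean_cost_rate_measurable cU hX hJ lambda0 rdirac ry' PX).
have mGs : measurable_fun (halfline R) Gs.
  exact: (mean_cost_rate_measurable cU hX hJ lambda0 rsigma ry PX).
have intGu := mean_cost_rate_integrable cU hX hJ lambda0 rdirac ry' PX.
have intGs := mean_cost_rate_integrable cU hX hJ lambda0 rsigma ry PX.
have sub : (`[0, T]%classic : set R) `<=` halfline R.
  by move=> s /=; rewrite !in_itv/= andbT => /andP[].
have mw := control_weight_measurable.
have mq := mean_node_rate_measurable.
have mi := measurable_chattering_indicator midx.
(* Three errors: [S0] comes from replacing the trajectories [y'] by [y], [S2] from replacing [sigma]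
   by its masses at the nodes, [S1] from chattering. The first two are bounded at each time, the
   last one after integration. *)
pose S1 s : R := \sum_(j < N) ((idx s == j)%:R - control_weight j s) * mean_node_rate j s.
pose S0 s : R := Gu s - \sum_(j < N) (idx s == j)%:R * mean_node_rate j s.
pose S2 s : R := \sum_(j < N) control_weight j s * mean_node_rate j s - Gs s.
have mS1 : measurable_fun (halfline R) S1.
  apply: (@measurable_sum _ _ R _ 'I_N _
    (fun j s => ((idx s == j)%:R - control_weight j s) * mean_node_rate j s)) => j.
  by apply: measurable_funM => //; apply: measurable_funB.
have mS0 : measurable_fun (halfline R) S0.
  apply: measurable_funB => //.
  apply: (@measurable_sum _ _ R _ 'I_N _ (fun j s => (idx s == j)%:R * mean_node_rate j s)) => j.
  exact: measurable_funM.
have mS2 : measurable_fun (halfline R) S2.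
  apply: measurable_funB => //.
  apply: (@measurable_sum _ _ R _ 'I_N _
    (fun j s => control_weight j s * mean_node_rate j s)) => j.
  exact: measurable_funM.
have GE s : Gu s - Gs s = S0 s + S2 s + S1 s.
  rewrite /S0 /S1 /S2.
  have -> : \sum_(j < N) ((idx s == j)%:R - control_weight j s) * mean_node_rate j s =
    \sum_(j < N) (idx s == j)%:R * mean_node_rate j s -
    \sum_(j < N) control_weight j s * mean_node_rate j s.
    by rewrite -sumrB; apply: eq_bigr => j _; rewrite mulrBl.
  ring.
have S0B s : (`[0, T]%classic : set R) s -> `|S0 s| <= `|LJ| * n%:R * d.
  rewrite /= in_itv/= => /andP[s0 sT]; rewrite /S0 (chattering_sum_select (mean_node_rate^~ s))//.
  apply: mean_dist.
  - apply: (mean_integrable cU hX rdirac ry' PX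
      (g := (cost_rate lambda J (dirac_control chattering_control))^~ s) s0
      (fun z z' => cost_rate_lipschitz cU hJ lambda0 rdirac z z' s0)
      (fun f Xf => cost_rate_dominated cU hX hJ lambda0 rdirac ry' M0_ge0 Xf s0 JM)).
  - exact: node_rate_mean_integrable.
  - move=> f Xf; rewrite (cost_rate_dirac lambda cU hJ)//.
    apply: (le_trans (node_rate_lipschitz (idx s) _ _ s0)).
    by rewrite ler_wpM2l ?mulr_ge0//; exact: yd.
have S2B s : (`[0, T]%classic : set R) s -> `|S2 s| <= w.
  rewrite /= in_itv/= => /andP[s0 sT]; rewrite /S2.
  have iZ j : P.-integrable X
      (EFin \o (fun f => control_weight j s * node_rate j (y f s) s)).
    by apply: (integrableZl (functions_measurable hX) (control_weight j s)
      (node_rate_mean_integrable j s0)).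
  have -> : \sum_(j < N) control_weight j s * mean_node_rate j s =
      \int[P]_(f in X) (\sum_(j < N) control_weight j s * node_rate j (y f s) s).
    rewrite (@Rintegral_sum _ _ _ P X N
      (fun j f => control_weight j s * node_rate j (y f s) s))//; last first.
      exact: (functions_measurable hX).
    apply: eq_bigr => j _; rewrite RintegralZl//; first exact: (functions_measurable hX).
    exact: node_rate_mean_integrable.
  apply: mean_dist.
  - apply: (@integrable_sum_ord _ _ _ P X N
      (fun j f => control_weight j s * node_rate j (y f s) s)) => //.
    exact: (functions_measurable hX).
  - apply: (mean_integrable cU hX rsigma ry PX
      (g := (cost_rate lambda J sigma)^~ s) s0
      (fun z z' => cost_rate_lipschitz cU hJ lambda0 rsigma z z' s0)
      (fun f Xf => cost_rate_dominated cU hX hJ lambda0 rsigma ry M0_ge0 Xf s0 JM)).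
  - move=> f Xf; have /andP[e0 e1] := discount_le1 lambda0 s0.
    have xy : `|x - y f s| <= C * T.
      apply: (le_trans (relaxed_traj_dist_start cU hX rsigma ry Xf s0)).
      by rewrite ler_wpM2l// ltW.
    have := relaxed_average_partition cU rsigma s0 cA
      (@cost_extU_continuous _ _ _ _ _ _ hJ (y f s)) (fun j r Ar => Aw j r _ Ar xy).
    have -> : \sum_(j < N) control_weight j s * node_rate j (y f s) s =
      expR (- lambda * s) * \sum_(j < N)
        extU (fun u => J (y f s, u)) (c j) * fine (sigma s (A j)).
      rewrite mulr_sumr; apply: eq_bigr => j _.
      by rewrite -val_control_node extU_val /node_rate /control_weight; ring.
    rewrite -mulrBr normrM (ger0_norm e0) distrC => hw.
    by apply: le_trans hw; rewrite ler_piMl.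
have S1B s : (`[0, T]%classic : set R) s -> `|S1 s| <= 2 * B.
  rewrite /= in_itv/= => /andP[s0 sT].
  exact: (chattering_sum_le control_weight_ge0 control_weight_sum idxN
    (p := mean_node_rate^~ s) s0 B_ge0 (fun j _ => mean_node_rate_bound j s0 sT)).
have m02 : measurable_fun (`[0, T]%classic : set R) (fun s => S0 s + S2 s).
  by apply: measurable_funD; [apply: measurable_funS mS0|apply: measurable_funS mS2].
have S02B s : (`[0, T]%classic : set R) s -> `|S0 s + S2 s| <= `|LJ| * n%:R * d + w.
  move=> sI; apply: (le_trans (ler_normD _ _)); apply: lerD; [exact: S0B|exact: S2B].
have mS1' : measurable_fun (`[0, T]%classic : set R) S1 by apply: measurable_funS mS1.
have iGu : mu.-integrable `[0, T] (EFin \o Gu) by apply: integrableS intGu.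
have iGs : mu.-integrable `[0, T] (EFin \o Gs) by apply: integrableS intGs.
have e0 : \int[mu]_(s in `[0, T]) Gu s - \int[mu]_(s in `[0, T]) Gs s =
    \int[mu]_(s in `[0, T]) (S0 s + S2 s + S1 s).
  rewrite -(RintegralB _ iGu iGs); last exact: measurable_itv.
  by apply: eq_Rintegral => s _; exact: GE.
rewrite -/Gu -/Gs [X in `|X|]e0.
rewrite RintegralD//; last 2 first.
- exact: (bounded_itv_integrable m02 S02B).
- exact: (bounded_itv_integrable mS1' S1B).
apply: (le_trans (ler_normD _ _)); apply: lerD.
  by have := normr_itv_Rintegral_le T0 m02 S02B; rewrite subr0.
have Q0 : 0 <= `|LJ| * n%:R * C + lambda * B.
  by apply: addr_ge0; rewrite !mulr_ge0// ltW.
apply: (chattering_estimate control_weight_measurable control_weight_ge0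
  control_weight_sum h0 idxN midx idx_cell) => //.
- by rewrite mulr_ge0// ltW.
- by move=> j s _ s0 sT; exact: mean_node_rate_bound.
- move=> j s r _ s0 sT r0 rT sr.
  apply: (@le_trans _ _ ((`|LJ| * n%:R * C + lambda * B) * `|s - r|)); last by rewrite ler_wpM2l.
  apply: mean_dist; [exact: node_rate_mean_integrable..|].
  by move=> f Xf; exact: node_rate_oscillation.
Qed.

End cost.
End selection.
Lemma Rintegral_exp_tail (g : R -> R) (D c T : R) : 0 <= D -> 0 < c -> 0 <= T ->
  mu.-integrable (halfline R) (EFin \o g) ->
  (forall t, 0 <= t -> `|g t| <= D * expR (- c * t)) ->
  `|\int[mu]_(t in halfline R) g t - \int[mu]_(t in `[0, T]) g t| <= D / c * expR (- c * T).
Proof.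
move=> D0 c0 T0 ig gD.
have sub : (`]T, +oo[%classic : set R) `<=` halfline R.
  by move=> s /=; rewrite !in_itv/= !andbT => /ltW; exact: le_trans.
have sub' : (`[T, +oo[%classic : set R) `<=` halfline R.
  by move=> s /=; rewrite !in_itv/= !andbT; exact: le_trans.
have igT : mu.-integrable (`]T, +oo[%classic : set R) (EFin \o g) by apply: integrableS ig.
have igT' : mu.-integrable (`[T, +oo[%classic : set R) (EFin \o g) by apply: integrableS ig.
rewrite (Rintegral_itvB ig)// (Rintegral_itv_obnd_cbnd igT).
have [iD <-] := Rintegral_expRNM T D0 c0.
apply: normr_Rintegral_le => //.
  by apply/measurable_EFinP; case/integrableP: igT'.
by move=> s /sub'; rewrite /= in_itv/= andbT => s0; exact: gD.
Qed.

Lemma relaxed_control_approximation (P : probability (borel (FT_pointed n U)) R) (e : R) :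
  P X = 1%E -> 0 < e ->
  exists u y', [/\ ordinary_control u, ordinary_traj X u x y' &
    \int[mu]_(t in halfline R) mean_cost_rate X lambda J (dirac_control u) y' P t <=
    \int[mu]_(t in halfline R) mean_cost_rate X lambda J sigma y P t + e].
Proof.
move=> PX e0; have [M0 M0_ge0 JM] := cost_bound x cU hJ.
pose KJ : R := `|LJ| * n%:R; have KJ0 : 0 <= KJ by rewrite mulr_ge0.
have KJC0 : 0 <= KJ * C by rewrite mulr_ge0// ltW.
have LnC0 : 0 <= L * n%:R * C by rewrite !mulr_ge0// ltW.
pose D := M0 + 2 * (KJ * C) / lambda.
have D0 : 0 <= D by rewrite addr_ge0// divr_ge0 ?mulr_ge0// ltW.
pose k := lambda / 2; have k0 : 0 < k by rewrite divr_gt0.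
(* [T] solves D / k = (e / 8) k T; since k T <= exp(k T), each of the two tails beyond [T] is then
   at most e / 8. *)
pose T := 8 * D / (k * e) / k.
have T0 : 0 <= T by rewrite !divr_ge0 ?mulr_ge0// ltW// mulr_gt0.
have tail : D / k * expR (- k * T) <= e / 8.
  rewrite mulNr expRN ler_pdivrMr ?expR_gt0//.
  have h1 := expR_ge1Dx (k * T).
  have -> : D / k = e / 8 * (k * T) by rewrite /T; field; rewrite !gt_eqF.
  by rewrite ler_wpM2l ?divr_ge0 ?ltW//; lra.
pose B := M0 + KJ * C * T.
have B0 : 0 <= B by rewrite addr_ge0// mulr_ge0.
pose E := expR (2 * K * T); have E0 : 0 < E by exact: expR_gt0.
(* [P1] and [P2] are the coefficients of [a] and [h] in the cost defect on [0, T]. They depend on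
   [T] but not on the partition, so [w], [a] and [h] can be fixed now; each contributes at most e /
   8. *)
pose P1 := KJ * (2 * E) * T.
have KE0 : 0 <= KJ * (2 * E) by apply: mulr_ge0 => //; rewrite mulr_ge0// ltW.
have P10 : 0 <= P1 by exact: mulr_ge0.
pose P2 := KJ * (2 * E) * (2 * (L * n%:R * C) + 2 * C) * T +
  2 * (KJ * C + lambda * B) * T + 2 * B.
have lB : 0 <= lambda * B by rewrite mulr_ge0// ltW.
have P20 : 0 <= P2.
  apply: addr_ge0; last exact: mulr_ge0.
  apply: addr_ge0; last by apply: mulr_ge0 => //; apply: mulr_ge0 => //; exact: addr_ge0.
  apply: mulr_ge0 => //; apply: mulr_ge0 => //.
  by apply: addr_ge0; apply: mulr_ge0 => //; exact: ltW.
have e8 : 0 < e / 8 by rewrite divr_gt0.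
pose w := e / 8 / (T + 1); have w0 : 0 < w by rewrite divr_gt0// ltr_wpDl.
pose a := e / 8 / (P1 + 1); have a0 : 0 < a by rewrite divr_gt0// ltr_wpDl.
pose h := e / 8 / (P2 + 1); have h0 : 0 < h by rewrite divr_gt0// ltr_wpDl.
have [N [c [A [cA Aw Aa]]]] := exists_control_partition (C * T) w0 a0.
have [idx [idxN midx idx_cell]] := exists_chattering_selection
  (control_weight_measurable cA) (control_weight_ge0 A) (control_weight_sum cA) h0.
pose u := chattering_control cA idx.
have ou : ordinary_control u := chattering_control_ordinary cA midx.
(* The trajectory defect grows linearly in t; as 1 and t are both at most exp(2Kt), the sum of its
   coefficients bounds it in the weighted norm. *)
pose eta := a + 2 * (L * n%:R * C * h) + 2 * C * h.
have r1 : 0 <= 2 * (L * n%:R * C * h).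
  by apply: mulr_ge0 => //; apply: mulr_ge0 => //; exact: ltW.
have r2 : 0 <= 2 * C * h by apply: mulr_ge0; [rewrite mulr_ge0// ltW|exact: ltW].
have q0 : 0 <= a + 2 * (L * n%:R * C * h) := addr_ge0 (ltW a0) r1.
have eta0 : 0 <= eta := addr_ge0 q0 r2.
(* A trajectory is picked for each f independently. No regularity in f is lost, since stability
   makes any such family continuous on X; outside X the choice is arbitrary. *)
have /choice [y' y'P] : forall f : FT n U, exists yf : R -> 'rV[R]_n, X f ->
    caratheodory_solution (relaxed_field (dirac_control u) f) x yf /\
    forall t : R, 0 <= t -> `|yf t - y f t| <= 2 * eta * expR (2 * K * t).
  move=> f; have [Xf|nXf] := pselect (X f); last by exists (y f).
  have cF := relaxed_field_caratheodory cU hX (dirac_relaxed_control ou) Xf.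
  have [cy _] := relaxed_traj_solution ry Xf.
  have [|yf yf1 yf2] := picard_near_approximate_solution (x := x) cF K0 eta0 cy.
    move=> t t0 i.
    have := chattering_traj_defect cA h0 idxN midx idx_cell Xf (ltW a0)
      (fun j r z => @Aa j r f i z Xf) t0.
    move=> /le_trans; apply.
    have E1 : 1 <= expR (2 * K * t).
      by rewrite -[leLHS]expR0 ler_expR; apply: mulr_ge0 => //; rewrite mulr_ge0// ltW.
    have Et : t <= expR (2 * K * t).
      apply: (@le_trans _ _ (2 * K * t)); first by rewrite ler_peMl//; have := K1; lra.
      by apply: le_trans (expR_ge1Dx _); rewrite lerDr.
    rewrite /eta addrA -mulrDl [leRHS]mulrDl; apply: lerD; first exact: ler_wpM2l.
    by rewrite -[leLHS]mulr1; exact: ler_wpM2l.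
  by exists yf => _.
have ry' : relaxed_traj X (dirac_control u) x y' by move=> f /y'P[].
exists u, y'; split => //; first exact: (ordinary_trajP x cU hX u y').2 ry'.
set Gu := mean_cost_rate X lambda J (dirac_control u) y' P.
set Gs := mean_cost_rate X lambda J sigma y P.
have defect := @chattering_cost_defect _ _ _ _ cA h0 _ idxN midx idx_cell P PX y' ry'
  M0 T M0_ge0 T0 JM (2 * eta * E) w (ltW w0).
have {}defect : `|\int[mu]_(t in `[0, T]) Gu t - \int[mu]_(t in `[0, T]) Gs t| <=
    (KJ * (2 * eta * E) + w) * T + (2 * ((KJ * C + lambda * B) * h) * T + 2 * B * h).
  apply: defect => //.
  move=> f t Xf t0 tT; have [_ /(_ t t0)] := y'P f Xf; move=> /le_trans; apply.
  apply: ler_wpM2l; first by rewrite mulr_ge0.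
  by rewrite ler_expR ler_wpM2l// mulr_ge0// ltW.
have tu : `|\int[mu]_(t in halfline R) Gu t - \int[mu]_(t in `[0, T]) Gu t| <= e / 8.
  apply: le_trans tail; apply: Rintegral_exp_tail => //.
    exact: (mean_cost_rate_integrable cU hX hJ lambda0 (dirac_relaxed_control ou) ry' PX).
  move=> t t0; exact: (mean_cost_rate_dominated cU hX hJ lambda0
    (dirac_relaxed_control ou) ry' PX M0_ge0 t0 JM).
have ts : `|\int[mu]_(t in halfline R) Gs t - \int[mu]_(t in `[0, T]) Gs t| <= e / 8.
  apply: le_trans tail; apply: Rintegral_exp_tail => //.
    exact: (mean_cost_rate_integrable cU hX hJ lambda0 rsigma ry PX).
  move=> t t0; exact: (mean_cost_rate_dominated cU hX hJ lambda0 rsigma ry PX M0_ge0 t0 JM).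
have small (p : R) : 0 <= p -> p * (e / 8 / (p + 1)) <= e / 8.
  move=> p0; rewrite [leLHS]mulrA ler_pdivrMr; last by rewrite ltr_wpDl.
  by rewrite mulrDr mulr1 [p * _]mulrC lerDl ltW.
have sw : T * w <= e / 8 := small T T0.
have sa : P1 * a <= e / 8 := small P1 P10.
have sh : P2 * h <= e / 8 := small P2 P20.
have total : (KJ * (2 * eta * E) + w) * T + (2 * ((KJ * C + lambda * B) * h) * T + 2 * B * h) =
  T * w + P1 * a + P2 * h by rewrite /P1 /P2 /eta; ring.
rewrite total in defect; move: defect tu ts.
move: (\int[mu]_(t in `[0, T]) Gu t) (\int[mu]_(t in `[0, T]) Gs t)
  (\int[mu]_(t in halfline R) Gu t) (\int[mu]_(t in halfline R) Gs t) => i1 i2 i3 i4.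
move: (T * w) (P1 * a) (P2 * h) sw sa sh => x1 x2 x3.
rewrite !ler_norml; lra.
Qed.

End Relaxation.

(** * Lower semicontinuity and the inclusion of strict subdifferentials *)

Unset Implicit Arguments.

Theorem mainTheorem8 (R : realType) (n m : nat)
    (U : set 'rV[R]_m) (X : set (FT n U)) (L C LJ lambda : R)
    (J : dom n U -> R) (pi : R -> probability (borel (FT n U)) R)
    (t : R) (x : 'rV[R]_n)
    (sigma : R -> probability (borel 'rV[R]_m) R) (y : FT n U -> R -> 'rV[R]_n) :
  compact U ->
  H1 X L C ->
  H2 J LJ ->
  L < lambda ->
  (* pi is weak-* lower semicontinuous and each pi(s) is concentrated on X *)
  (forall s, 0 <= s -> pi s X = 1%E) ->
  (forall c : FT n U -> R, {within X, continuous c} ->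
     forall s, 0 <= s -> lsc_at (fun r => \int[pi r]_(f in X) c f) s) ->
  0 <= t ->
  (* sigma is an optimal relaxed control for V(t, x), y its trajectories *)
  relaxed_control U sigma ->
  relaxed_traj X sigma x y ->
  value X pi J lambda t x = relaxed_cost X pi J lambda sigma y t ->
  (forall s, 0 <= s -> lsc_at (relaxed_cost X pi J lambda sigma y) s) /\
  strict_subdiff (fun s => value X pi J lambda s x) t
    `<=` strict_subdiff (relaxed_cost X pi J lambda sigma y) t.
Proof.
move=> cU hX hJ Llambda piX pi_lsc t0 rsigma ry opt.
have lambda0 : 0 < lambda by case: hX => _ [_ [L0 _]]; exact: lt_trans Llambda.
have value_le s : 0 <= s ->
    value X pi J lambda s x <= relaxed_cost X pi J lambda sigma y s.
  (* An ordinary control need not attain the relaxed cost, so the inequality is proved up to every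
     positive [e]. *)
  move=> s0; apply/ler_addgt0Pr => e e0.
  have [u [y' [ou oy' le_e]]] := relaxed_control_approximation cU hX hJ lambda0 rsigma ry
    (P := as_pointed (pi s)) (piX s s0) e0.
  apply: (le_trans (value_le_ordinary_cost cU hX hJ lambda0 (piX s s0) ou oy')).
  by rewrite (ordinary_costE X lambda cU hJ) !relaxed_costE.
split=> [s s0|xi Vxi e e0].
  exact: (relaxed_cost_lsc cU hX hJ lambda0 rsigma ry piX pi_lsc s0).
have [d [d0 dP]] := Vxi e e0; exists d; split => // s s0 st.
apply: le_trans (dP s s0 st); rewrite opt.
have := value_le s s0.
move: (value _ _ _ _ _ _) (relaxed_cost _ _ _ _ _ _ s) (relaxed_cost _ _ _ _ _ _ t).
by move=> a b c; lra.
Qed.
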